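(* Let $n\ge 2$ and $\mu>0$, and let $\mathbf{X}(t)=(\mathbf{W}(t),\mathbf{S}(t))$, $t\ge 0$, be the Moran Genealogy Process of size $n$ with event rate $\mu$, with state space $\mathcal{X}^n=\mathcal{W}^n\times\mathbb{R}_+^{n-1}$. Then $\mathbf{X}$ has a unique invariant probability measure, namely \[ \pi_n(d\mathbf{w}\,d\mathbf{s}) = \left(\frac{\mu}{\binom{n}{2}}\right)^{n-1}\exp\left(-\sum_{j=1}^{n-1}\frac{\binom{j+1}{2}}{\binom{n}{2}}\,\mu\,\mathbf{s}_j\right)d\mathbf{w}\,d\mathbf{s}, \] where $d\mathbf{w}$ is counting measure on $\mathcal{W}^n$ and $d\mathbf{s}$ is Lebesgue measure on $\mathbb{R}_+^{n-1}$. Moreover, $\mathbf{X}$ is uniformly and exponentially ergodic: there are constants $D<\infty$ and $0\le\rho<1$ such that $\|\nu K^t-\pi_n\|_{\mathrm{TV}}<D\rho^t$ for all $t\ge 0$ and all probability measures $\nu$ on $\mathcal{X}^n$.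
   Context: A population of constant size $n$ evolves in continuous time: Moran events occur at the times of a Poisson process of rate $\mu$; at each event an ordered pair $(u,v)$ of distinct living individuals is chosen uniformly at random, $u$ dies and $v$ gives birth, the newborn taking over the label $u$. The state at time $t$ is the genealogy of the $n$ living individuals (leaves labelled $1,\dots,n$). $\mathcal{W}^n$ is the finite set of ranked leaf-labelled rooted binary tree topologies on leaves $\{1,\dots,n\}$, i.e. binary trees with $n-1$ internal nodes totally ordered in time (rank $1$ = root, each internal node ranked after its parent); $|\mathcal{W}^n|=n!(n-1)!/2^{n-1}$. $\mathbf{W}(t)\in\mathcal{W}^n$ is the ranked topology of the genealogy at time $t$. If $T_1\le\dots\le T_{n-1}$ are the times of the internal nodes (most recent common ancestors) at time $t$, then $\mathbf{S}(t)=(\mathbf{s}_1,\dots,\mathbf{s}_{n-1})$ with $\mathbf{s}_m=T_{m+1}-T_m$ for $m<n-1$ and $\mathbf{s}_{n-1}=t-T_{n-1}$ (coalescent intervals). At a Moran event with pair $(u,v)$, leaf $u$ and its parent node are removed (the sibling subtree of $u$ being reattached to the parent of the removed node), and a new internal node of latest rank, at the current time, is inserted on the lineage of $v$ with children $u$ and $v$; between events the last interval $\mathbf{s}_{n-1}$ grows linearly. $\mathbf{X}$ is a càdlàg continuous-time Markov process. $K^t$ is its transition semigroup, $(\nu K^t)(E)=\int\nu(d\mathbf{x})P^t(\mathbf{x},E)$ with $P^t(\mathbf{x},E)=\Pr(\mathbf{X}(t)\in E\mid\mathbf{X}(0)=\mathbf{x})$, and $\|\mu\|_{\mathrm{TV}}=\sup_{|f|\le1}|\mu(f)|$.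 *)

(* Defs.v *)
From HB Require Import structures.
From mathcomp Require Import all_boot all_order all_algebra.
From mathcomp Require Import all_classical all_reals all_analysis.
From mathcomp Require Import zify.
Set Implicit Arguments. Unset Strict Implicit. Unset Printing Implicit Defensive.
Import Order.TTheory GRing.Theory Num.Theory.

Section Trees.
Variable n : nat.
Implicit Types c : {ffun 'I_n * 'I_n -> 'I_n}.

Definition rlvl c (k : nat) (i j : 'I_n) : bool := (i == j) || (k <= c (i, j))%N.

Definition rclasses c (k : nat) : {set {set 'I_n}} :=
  [set [set j | rlvl c k i j] | i : 'I_n].

Definition is_rtree c : bool :=
  [forall i, val (c (i, i)) == 0%N] &&
  [forall i, forall j, c (i, j) == c (j, i)] &&
  [forall k : 'I_n.+1, (0 < k)%N ==>
     ([forall i, forall j, forall l, rlvl c k i j ==> rlvl c k j l ==> rlvl c k i l]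
      && (#|rclasses c k| == k))].

Definition cater : {ffun 'I_n * 'I_n -> 'I_n} :=
  [ffun ij : 'I_n * 'I_n => if ij.1 == ij.2 then insubd ij.1 0%N
              else insubd ij.1 (n - maxn ij.1 ij.2)%N].

Lemma cater_val (i j : 'I_n) :
  val (cater (i, j)) = if i == j then 0%N else (n - maxn i j)%N.
Proof.
rewrite ffunE /=; case: eqP => [->|/eqP ij]; rewrite val_insubd.
  by rewrite (leq_ltn_trans (leq0n _) (ltn_ord j)).
have : (0 < maxn i j)%N.
  case: (posnP i) => [i0|]; last by move=> h; rewrite leq_max h.
  case: (posnP j) => [j0|]; last by move=> h; rewrite leq_max h orbT.
  by move: ij; rewrite -val_eqE /= i0 j0.
move=> h; have hi := ltn_ord i; have hj := ltn_ord j.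
have -> : (n - maxn i j < n)%N by lia.
by [].
Qed.

Lemma cater_lvl (k : nat) (i j : 'I_n) : (0 < k <= n)%N ->
  rlvl cater k i j = (i == j) || (maxn i j <= n - k)%N.
Proof.
move=> /andP[k0 kn]; rewrite /rlvl cater_val; case: eqP => //= _.
have hi := ltn_ord i; have hj := ltn_ord j; apply/idP/idP; lia.
Qed.

Lemma cater_ok : is_rtree cater.
Proof.
apply/andP; split; first (apply/andP; split).
- by apply/forallP => i; rewrite cater_val eqxx.
- apply/forallP => i; apply/forallP => j; rewrite -val_eqE !cater_val eq_sym maxnC.
  by rewrite (eq_sym j i).
apply/forallP => k; apply/implyP => k0.
have kn : (0 < k <= n)%N by rewrite k0 -ltnS ltn_ord.
apply/andP; split.
  apply/forallP => i; apply/forallP => j; apply/forallP => l.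
  rewrite !cater_lvl //; apply/implyP => h1; apply/implyP => h2.
  case/orP: h1 => [/eqP->//|h1]; case/orP: h2 => [/eqP<-|h2]; first by rewrite h1 orbT.
  by apply/orP; right; move: h1 h2; rewrite !geq_max; lia.
set A := [set j : 'I_n | (j <= n - k)%N].
set B := [set i : 'I_n | (n - k < i)%N].
have cls i : [set j | rlvl cater k i j] = if (i <= n - k)%N then A else [set i].
  apply/setP => j; rewrite !inE cater_lvl //; case: ifP => ik.
    rewrite inE; apply/idP/idP; last by move=> h; rewrite geq_max h ik orbT.
    by case/orP => [/eqP<-//|]; rewrite geq_max => /andP[].
  rewrite inE eq_sym; case: eqP => //= _; apply/negbTE; rewrite geq_max ik.
  by [].
have -> : rclasses cater k = A |: [set [set i] | i in B].
  apply/setP => X; rewrite !inE; apply/imsetP/idP.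
    move=> [i _ ->]; rewrite cls; case: ifP => ik; first by rewrite eqxx.
    by apply/orP; right; apply/imsetP; exists i; rewrite // inE ltnNge ik.
  case/orP => [/eqP->|/imsetP[i]]; last first.
    rewrite inE => ik ->; exists i => //; rewrite cls ifN //; lia.
  have n0 : (0 < n)%N by case/andP: kn => ? ?; lia.
  exists (Ordinal n0) => //; rewrite cls ifT //.
rewrite cardsU1 card_imset; last exact: set1_inj.
have -> : (A \notin [set [set i] | i in B]) = true.
  apply/negbT/negP => /imsetP[i]; rewrite inE => ik /setP /(_ i).
  rewrite !inE eqxx; lia.
have -> : #|B| = (k - 1)%N.
  rewrite cardE /enum_mem size_filter -[Finite.enum _]enumT.
  rewrite (eq_count (a2 := preim val (fun x => n - k < x)%N)); last by move=> x; rewrite -[mem B x]/(x \in B) inE.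
  rewrite -(count_map val) val_enum_ord.

  have e : n = ((n - k).+1 + (k - 1))%N by lia.
  rewrite [X in iota 0 X]e.
  rewrite iotaD count_cat add0n.
  rewrite (eq_in_count (a2 := pred0)); last first.
    by move=> x; rewrite mem_iota /=; lia.
  rewrite count_pred0 add0n (eq_in_count (a2 := predT)); last first.
    by move=> x; rewrite mem_iota /=; lia.
  by rewrite count_predT size_iota.
by apply/eqP; rewrite /=; lia.
Qed.

Definition rtree : Type := {c : {ffun 'I_n * 'I_n -> 'I_n} | is_rtree c}.
HB.instance Definition _ := [Finite of rtree by <:].
HB.instance Definition _ := isPointed.Build rtree (exist _ cater cater_ok).
HB.instance Definition _ := @isMeasurable.Build default_measure_display rtree
  discrete_measurable discrete_measurable0
  discrete_measurableC discrete_measurableU.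

(* rank of the parent node of leaf u *)
Definition prank (w : rtree) (u : 'I_n) : nat :=
  \max_(x : 'I_n | x != u) val (val w (u, x)).

(* tree part of a Moran event (u dies, v reproduces) *)
Definition moran_raw (w : rtree) (u v : 'I_n) : {ffun 'I_n * 'I_n -> 'I_n} :=
  let c := val w in
  let m := prank w u in
  let sh (r : 'I_n) : nat := if (r < m)%N then val r else (val r).-1 in
  [ffun xy : 'I_n * 'I_n =>
     let x := xy.1 in let y := xy.2 in
     insubd (c xy)
       (if x == y then 0%N
        else if x == u then (if y == v then n.-1 else sh (c (v, y)))
        else if y == u then (if x == v then n.-1 else sh (c (v, x)))
        else sh (c xy))].

(* moran_raw of a ranked tree is a ranked tree; insubd only serves to give
   the result the type rtree (its default value w is never used). *)
Definition moran_tree (w : rtree) (u v : 'I_n) : rtree :=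
  insubd w (moran_raw w u v).

End Trees.

Section MGP.
Variable R : realType.
Variable n : nat.
Local Open Scope ring_scope.

(* state: tree topology and coalescent intervals s_1..s_{n-1}
   (s_j is stored at tuple position j-1) *)
Definition mstate : Type := (rtree n * (n.-1).-tuple R)%type.

Definition Xspace : set mstate := [set x | forall i, 0 <= tnth x.2 i].

Definition flow (t : R) (x : mstate) : mstate :=
  (x.1, [tuple (if i.+1 == n.-1 then tnth x.2 i + t else tnth x.2 i)
         | i < n.-1]).

(* coalescent intervals after removal of the node of rank m and
   insertion of a new node of latest rank at the current time *)
Definition move_s (s : (n.-1).-tuple R) (m : nat) : (n.-1).-tuple R :=
  let sj (j : nat) := nth 0 s j.-1 in
  [tuple (if (i.+1 < m.-1)%N then sj i.+1
          else if i.+1 == m.-1 then sj m.-1 + sj m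
          else if (i.+1 < n.-1)%N then sj i.+2
          else 0) | i < n.-1].

Definition jump (u v : 'I_n) (x : mstate) : mstate :=
  (moran_tree x.1 u v, move_s x.2 (prank x.1 u)).

Variable mu : R.

(* Pk k t x E = Pr(exactly k events in [0,t] and X(t) \in E | X(0) = x),
   obtained by conditioning on the time r of the first event *)
Fixpoint Pk (k : nat) (t : R) (x : mstate) (E : set mstate) : \bar R :=
  match k with
  | 0%N => ((expR (- (mu * t)))%:E * (\1_E (flow t x))%:E)%E
  | k'.+1 =>
      (\int[@lebesgue_measure R]_(r in `[0%R, t])
         ((mu * expR (- (mu * r)) / (n * n.-1)%:R)%:E *
          \sum_(u : 'I_n) \sum_(v : 'I_n | v != u)
             Pk k' (t - r) (jump u v (flow r x)) E))%E
  end.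

Definition Ptrans (t : R) (x : mstate) (E : set mstate) : \bar R :=
  (\sum_(0 <= k <oo) Pk k t x E)%E.

Definition actK (nu : set mstate -> \bar R) (t : R) : set mstate -> \bar R :=
  fun E => (\int[nu]_x Ptrans t x E)%E.

Definition tv_dist (m1 m2 : set mstate -> \bar R) : \bar R :=
  ereal_sup [set `| (\int[m1]_y (f y)%:E - \int[m2]_y (f y)%:E)%E |%E
            | f in [set f : mstate -> R |
                     measurable_fun setT f /\ forall y, `|f y| <= 1]].

Fixpoint iint (k : nat) : (k.-tuple R -> \bar R) -> \bar R :=
  match k as k0 return (k0.-tuple R -> \bar R) -> \bar R with
  | 0%N => fun g => g [tuple]
  | k'.+1 => fun g =>
      (\int[@lebesgue_measure R]_(y in `[0%R, +oo[)
          iint (fun s : k'.-tuple R => g [tuple of y :: s]))%E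
  end.

Definition pi_dens (s : (n.-1).-tuple R) : R :=
  (mu / 'C(n, 2)%:R) ^+ n.-1 *
  expR (- \sum_(j < n.-1) ('C(j.+2, 2)%:R / 'C(n, 2)%:R) * mu * tnth s j).

Definition pi_n (E : set mstate) : \bar R :=
  (\sum_(w : rtree n) iint (fun s => (pi_dens s)%:E * (\1_E (w, s))%:E))%E.

End MGP.

(* Main.v *)
(** Invariance.  Write [pi] for the candidate law and [slice h b] for its
    marginal on the states whose last interval is [b].  A uniform Moran event
    followed by a flow of duration [b], weighted by the event rate, maps [pi] to
    [slice _ b]: every tree arises from exactly [2 m] events that remove the node
    of rank [m], and removing a node of rank [m] with probability proportional to
    [m] turns the product of exponential laws of [n - 1] intervals into the one
    of [n - 2] intervals.  Let [A j] be the mass that [pi] sends to [E] in time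
    [t] through exactly [j] events, and [B j] the mass reaching [E] when an event
    hits the law [pi] at some time [r <= t] and exactly [j] events follow.
    Splitting [pi] before that event according to its last interval [b], namely
    [b <= r] or [b > r], gives
    [pi E = A 0 + B 0] and [B j = A (j + 1) + B (j + 1)], with [B j] tending to 0.

    Ergodicity.  Two copies driven by the same event times and pairs coalesce as
    soon as the events [(1, 0), (2, 0), ..., (n - 1, 0)] occur consecutively, so
    that the oscillation of [x |-> P^t(x, E)] decays exponentially, uniformly in
    [E]; uniqueness follows. *)

Require Import Defs.
From HB Require Import structures.
From mathcomp Require Import all_boot all_order all_algebra.
From mathcomp Require Import zify.
Set Implicit Arguments. Unset Strict Implicit. Unset Printing Implicit Defensive.
Import GRing.Theory.

Section ClassCount.
Variable T : finType.
Implicit Types (P Q : rel T) (A : {set T}).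

Lemma eq_card_imset_ker (S1 S2 : finType) (A : {set T}) (f : T -> S1)
    (g : T -> S2) :
  {in A &, forall x y, (f x == f y) = (g x == g y)} -> #|f @: A| = #|g @: A|.
Proof.
move=> fg; have [->|[x0 x0A]] := set_0Vmem A; first by rewrite !imset0 !cards0.
pose h (z : S1) := if [pick x in A | f x == z] is Some x then g x else g x0.
have hf x : x \in A -> h (f x) = g x.
  move=> xA; rewrite /h; case: pickP => [y /andP[yA fy]|/(_ x)].
    by apply/eqP; rewrite -fg.
  by rewrite xA eqxx.
have -> : g @: A = h @: (f @: A).
  apply/setP => z; apply/imsetP/imsetP.
    by move=> [x xA ->]; exists (f x); rewrite ?hf ?imset_f.
  by move=> [_ /imsetP[x xA ->] ->]; exists x; rewrite ?hf.
rewrite [RHS]card_in_imset // => _ _ /imsetP[x xA ->] /imsetP[y yA ->].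
by rewrite !hf // => /eqP; rewrite -fg // => /eqP.
Qed.

Definition nclasses P A := #|[set [set y in A | P x y] | x in A]|.

Lemma class_eqE P A : {in A & &, equivalence_rel P} ->
  {in A &, forall x y, ([set z in A | P x z] == [set z in A | P y z]) = P x y}.
Proof.
move=> eP x y xA yA; apply/eqP/idP => [/setP/(_ y)|Pxy].
  by rewrite !inE yA /= (eP y y y yA yA yA).1.
by apply/setP => z; rewrite !inE; case: (boolP (z \in A)) => //= zA;
  exact: (eP x y z xA yA zA).2.
Qed.

Lemma nclasses_imset (S : finType) P A (f : T -> S) :
  {in A &, forall x y, (f x == f y) = P x y} -> nclasses P A = #|f @: A|.
Proof.
move=> fP; apply: eq_card_imset_ker => x y xA yA; rewrite fP // class_eqE //.
move=> {}x {}y z {}xA {}yA zA; rewrite -!fP // eqxx; split=> // /eqP fxy.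
by rewrite fxy.
Qed.

Lemma eq_nclasses P Q A : {in A &, P =2 Q} -> nclasses P A = nclasses Q A.
Proof.
move=> PQ; rewrite /nclasses.
congr (#|pred_of_set _|); apply: eq_in_imset => x xA.
by apply/setP => y; rewrite !inE; case: (boolP (y \in A)) => //= yA; exact: PQ.
Qed.

Lemma nclasses_alone P u : equivalence_rel P -> (forall x, P u x -> x = u) ->
  nclasses P setT = (nclasses P [set~ u]).+1.
Proof.
move=> eP Pu; pose f x := [set y | P x y].
have fP A : {in A &, forall x y, (f x == f y) = P x y}.
  have eP' : {in setT & &, equivalence_rel P}.
    by move=> s t r _ _ _; exact: (eP s t r).
  move=> x y _ _; rewrite -(class_eqE eP') ?inE //.
  by congr (_ == _); apply/setP => z; rewrite !inE.
rewrite !(nclasses_imset (fP _)).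
have -> : [set: T] = u |: [set~ u] by rewrite setUCr.
rewrite imsetU1 cardsU1; case: imsetP => [[x]|] //=.
rewrite !inE => xu /eqP; rewrite (fP setT) // => /Pu xu'.
by rewrite xu' eqxx in xu.
Qed.

Lemma nclasses_mate P u a : equivalence_rel P -> a != u -> P u a ->
  nclasses P setT = nclasses P [set~ u].
Proof.
move=> eP au Pua; pose f x := [set y | P x y].
have fP A : {in A &, forall x y, (f x == f y) = P x y}.
  have eP' : {in setT & &, equivalence_rel P}.
    by move=> s t r _ _ _; exact: (eP s t r).
  move=> x y _ _; rewrite -(class_eqE eP') ?inE //.
  by congr (_ == _); apply/setP => z; rewrite !inE.
rewrite !(nclasses_imset (fP _)).
have -> : [set: T] = u |: [set~ u] by rewrite setUCr.
rewrite imsetU1 cardsU1; case: imsetP => [//|[]]; exists a; rewrite ?inE //.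
by apply/eqP; rewrite (fP setT).
Qed.

Lemma nclasses_sub_eq P Q A :
  {in A & &, equivalence_rel P} -> {in A & &, equivalence_rel Q} ->
  {in A &, forall x y, P x y -> Q x y} -> nclasses P A = nclasses Q A ->
  {in A &, P =2 Q}.
Proof.
move=> eP eQ PQ nPQ; pose F x := [set y in A | P x y].
pose G x := [set y in A | Q x y]; pose h (X : {set T}) := \bigcup_(x in X) G x.
have hF x : x \in A -> h (F x) = G x.
  move=> xA; apply/setP => z; apply/bigcupP/idP.
    move=> [y]; rewrite inE => /andP[yA /(PQ _ _ xA yA) Qxy].
    by rewrite !inE => /andP[zA]; rewrite zA (eQ x y z xA yA zA).2.
  by move=> zG; exists x => //; rewrite inE xA (eP x x x xA xA xA).1.
have hi : {in F @: A &, injective h}.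
  apply/imset_injP; have -> : h @: (F @: A) = G @: A.
    by rewrite -imset_comp; apply: eq_in_imset => x; exact: hF.
  exact/eqP/esym.
move=> x y xA yA; apply/idP/idP; first exact: PQ.
rewrite -(class_eqE eQ) // -(class_eqE eP) // => /eqP GG.
by apply/eqP; apply: hi; rewrite ?imset_f // !hF.
Qed.

End ClassCount.

Section RankedTrees.
Variable n : nat.
Implicit Types (w : rtree n) (d : 'I_n -> 'I_n -> nat) (u v a : 'I_n).

Definition rk w (x y : 'I_n) : nat := val (val w (x, y)).

Definition lvl d (k : nat) (x y : 'I_n) : bool := (x == y) || (k <= d x y)%N.

Lemma rk_inj w w' : (forall x y, rk w x y = rk w' x y) -> w = w'.
Proof. by move=> h; apply/val_inj/ffunP => -[x y]; apply/val_inj; exact: h. Qed.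

Lemma rk_lt w x y : (rk w x y < n)%N. Proof. exact: ltn_ord. Qed.

Lemma rk_diag w x : rk w x x = 0.
Proof. by have := valP w => /andP[/andP[/forallP/(_ x)/eqP]]. Qed.

Lemma rkC w x y : rk w x y = rk w y x.
Proof.
have := valP w => /andP[/andP[_ /forallP/(_ x)/forallP/(_ y)/eqP h] _].
by rewrite /rk h.
Qed.

Lemma lvl_rk_equiv w k : 0 < k -> equivalence_rel (lvl (rk w) k).
Proof.
move=> k0; apply/equivalence_relP; split=> [x|x y xy z]; first by rewrite /lvl eqxx.
have sy a b : lvl (rk w) k a b = lvl (rk w) k b a by rewrite /lvl eq_sym rkC.
suff tr a b c : lvl (rk w) k a b -> lvl (rk w) k b c -> lvl (rk w) k a c.
  by apply/idP/idP; apply: tr; rewrite // sy.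
have [kn|nk] := leqP k n; last first.
  rewrite {1}/lvl => /orP[/eqP->//|]; have := rk_lt w a b; lia.
have := valP w => /andP[_ /forallP /(_ (Ordinal (kn : k < n.+1)))].
move/implyP => /(_ k0) /andP[/forallP/(_ a)/forallP/(_ b)/forallP/(_ c) + _].
by move=> /implyP h /h /implyP h' /h'.
Qed.

Lemma nclasses_rclasses (c : {ffun 'I_n * 'I_n -> 'I_n}) k :
  #|rclasses c k| = nclasses (rlvl c k) setT.
Proof.
rewrite /nclasses; congr (#|pred_of_set _|); apply/setP => X.
apply/imsetP/imsetP => -[x _ ->]; exists x => //;
  by apply/setP => y; rewrite !inE.
Qed.

Lemma nclasses_rk w k : 0 < k <= n -> nclasses (lvl (rk w) k) setT = k.
Proof.
move=> /andP[k0 kn]; rewrite -[RHS](_ : #|rclasses (val w) k| = k).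
  by rewrite nclasses_rclasses.
have := valP w => /andP[_ /forallP /(_ (Ordinal (kn : k < n.+1)))].
by move/implyP => /(_ k0) /andP[_ /eqP].
Qed.

Lemma is_rtree_nclasses (c : {ffun 'I_n * 'I_n -> 'I_n}) :
  let r x y := val (c (x, y)) in
  (forall x, r x x = 0) -> (forall x y, r x y = r y x) ->
  (forall k, 0 < k <= n -> equivalence_rel (lvl r k)) ->
  (forall k, 0 < k <= n -> nclasses (lvl r k) setT = k) -> is_rtree c.
Proof.
move=> r r0 rC er nr; apply/andP; split; first (apply/andP; split).
- by apply/forallP => x; rewrite -/(r x x) r0.
- by apply/forallP => x; apply/forallP => y; rewrite -val_eqE; apply/eqP/rC.
apply/forallP => k; apply/implyP => k0.
have kn : 0 < k <= n by rewrite k0 -ltnS ltn_ord.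
rewrite nclasses_rclasses; apply/andP; split; last by apply/eqP/nr.
apply/forallP => x; apply/forallP => y; apply/forallP => z.
apply/implyP => xy; apply/implyP => yz.
by have := (er k kn x y z).2 xy; rewrite -[lvl _ _ x z]/(rlvl c k x z) => ->.
Qed.

(* [d] restricted to [~ u] ranks the tree on the leaves other than [u]. *)
Record redtree u d : Prop := Redtree {
  redC : {in [set~ u] &, forall x y, d x y = d y x};
  red_equiv : forall k, 0 < k -> {in [set~ u] & &, equivalence_rel (lvl d k)};
  red_nclasses : forall k, 0 < k < n -> nclasses (lvl d k) [set~ u] = k }.

Lemma card_setC1 u : #|[set~ u]| = n.-1.
Proof. by rewrite cardsC1 card_ord. Qed.

Lemma red_lt u d : redtree u d -> 1 < n ->
  {in [set~ u] &, forall x y, x != y -> d x y < n.-1}.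
Proof.
move=> rd n1 x y xV yV xy; rewrite ltnNge; apply/negP => h.
have n0 : 0 < n.-1 by lia.
have n0' : 0 < n.-1 < n by lia.
have e1 := red_nclasses rd n0'.
have id_eq : {in [set~ u] &, forall a b, (id a == id b) = (a == b)} by [].
have e2 : nclasses (fun a b : 'I_n => a == b) [set~ u] = n.-1.
  by rewrite (nclasses_imset id_eq) imset_id card_setC1.
have e3 : {in [set~ u] & &, equivalence_rel (fun a b : 'I_n => a == b)}.
  by move=> a b c _ _ _; split; rewrite ?eqxx // => /eqP->.
have := nclasses_sub_eq e3 (red_equiv rd n0).
rewrite e1 e2 => /(_ _ erefl) H.
have : lvl d n.-1 x y by rewrite /lvl h orbT.
by rewrite -H // ?(negbTE xy) // => a b _ _ /eqP->; rewrite /lvl eqxx.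
Qed.

(* Hangs [u] on the lineage of [a] below a new node of rank [m]. *)
Definition insr d u m a (x y : 'I_n) : nat :=
  let iu z := if lvl d m a z then m else d a z in
  if x == y then 0 else if x == u then iu y else if y == u then iu x
  else if d x y < m then d x y else (d x y).+1.

Lemma insrC d u m a : redtree u d -> forall x y, insr d u m a x y = insr d u m a y x.
Proof.
move=> rd x y; rewrite /insr [y == x]eq_sym; case: eqVneq => // xy.
case: (eqVneq x u) => xu; case: (eqVneq y u) => yu //; first by rewrite xu yu eqxx in xy.
by rewrite (redC rd) // !inE.
Qed.

Lemma lvl_insr d u m a k : redtree u d -> a != u -> 0 < k ->
  forall x y, lvl (insr d u m a) k x y =
    if k <= m then lvl d k (if x == u then a else x) (if y == u then a else y)
    else if (x == u) || (y == u) then x == y else lvl d k.-1 x y.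
Proof.
move=> rd au k0 x y; rewrite /lvl /insr /lvl /=.
case: (eqVneq x y) => [<-|xy]; first by rewrite !eqxx orbb; case: (x == u); case: (k <= m).
have dC (z : 'I_n) : z != u -> d z a = d a z by move=> zu; rewrite (redC rd) ?inE.
case: (eqVneq x u) => [xu|xu]; case: (eqVneq y u) => [yu|yu] /=.
- by rewrite xu yu eqxx in xy.
- by case: (eqVneq a y) => ay /=; case: (leqP m (d a y)) => h; case: (leqP k m) => h2 /=; lia.
- rewrite dC // [x == a]eq_sym.
  by case: (eqVneq a x) => ay /=; case: (leqP m (d a x)) => h; case: (leqP k m) => h2 /=; lia.
- by rewrite (negbTE xy) /=; case: (leqP m (d x y)) => h; case: (leqP k m) => h2 /=; lia.
Qed.

Lemma insr_equiv d u m a k : redtree u d -> a != u -> 0 < m -> 0 < k ->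
  equivalence_rel (lvl (insr d u m a) k).
Proof.
move=> rd au m0 k0 x y z; rewrite !(lvl_insr _ rd au k0).
have V t : (if t == u then a else t) \in [set~ u].
  by rewrite !inE; case: (eqVneq t u).
case: (leqP k m) => km.
  by apply: (red_equiv rd k0) => //; exact: V.
split; first by case: ifP => // _; rewrite /lvl eqxx.
case: (eqVneq x u) => [xu|xu] /=.
  by move=> /eqP <-; rewrite xu eqxx.
case: (eqVneq y u) => [yu|yu] /=; first by move/eqP=> xy; rewrite xy yu eqxx in xu.
case: (eqVneq z u) => [zu|zu] /=; first by rewrite zu (negbTE xu) (negbTE yu).
have k1 : 0 < k.-1 by lia.
by move=> xy; apply: (red_equiv rd k1 _ _ _).2 => //; rewrite !inE.
Qed.

Lemma nclasses_insr d u m a k : redtree u d -> a != u -> 0 < m < n -> 0 < k <= n ->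
  nclasses (lvl (insr d u m a) k) setT = k.
Proof.
move=> rd au m0 k0; have er := insr_equiv rd au (m := m) (k := k).
have k00 : 0 < k by lia.
have {}er := er _ k00; have {}er := er (ltac:(lia)).
have V x : x \in [set~ u] -> (x == u) = false by rewrite !inE => /negbTE.
case: (leqP k m) => km.
  rewrite (@nclasses_mate _ _ u a) //; last first.
    by rewrite (lvl_insr _ rd au k00) km eqxx (negbTE au) /lvl eqxx.
  rewrite -[RHS](red_nclasses rd (k := k)); last by lia.
  by apply: eq_nclasses => x y xV yV; rewrite (lvl_insr _ rd au k00) km !V.
rewrite (@nclasses_alone _ _ u) //; last first.
  by move=> x; rewrite (lvl_insr _ rd au k00) leqNgt km eqxx /= => /eqP.
rewrite (@eq_nclasses _ _ (lvl d k.-1)) ?(red_nclasses rd); [|lia|].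
  by rewrite prednK.
by move=> x y xV yV; rewrite (lvl_insr _ rd au k00) leqNgt km !V.
Qed.

Lemma is_rtree_insr d u m a (c : {ffun 'I_n * 'I_n -> 'I_n}) :
  redtree u d -> a != u -> 0 < m < n ->
  (forall x y, val (c (x, y)) = insr d u m a x y) -> is_rtree c.
Proof.
move=> rd au m0 cE.
have E k : lvl (fun x y => val (c (x, y))) k =2 lvl (insr d u m a) k.
  by move=> x y; rewrite /lvl /= -cE.
apply: is_rtree_nclasses => [x|x y|k /andP[k0 kn]|k k0].
- by rewrite cE /insr eqxx.
- by rewrite !cE insrC.
- have m00 : 0 < m by lia.
  by move=> x y z; rewrite !E; exact: insr_equiv.
- by rewrite -[RHS](nclasses_insr rd au m0 k0); apply: eq_nclasses => x y _ _; exact: E.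
Qed.

Lemma insr_lt d u m a x y : redtree u d -> a != u -> 0 < m < n -> insr d u m a x y < n.
Proof.
move=> rd au m0; have n1 : 1 < n by lia.
have L (s t : 'I_n) : s != u -> t != u -> s != t -> d s t < n.-1.
  by move=> su tu st; apply: (red_lt rd) => //; rewrite !inE.
rewrite /insr; case: eqVneq => [|xy]; first by lia.
have I (z : 'I_n) : z != u -> (if lvl d m a z then m else d a z) < n.
  move=> zu; case: ifP => [_|/norP[az _]]; first by lia.
  by have := L a z au zu az; lia.
case: eqVneq => [xu|xu]; first by apply: I; rewrite -xu eq_sym.
case: eqVneq => [yu|yu]; first by apply: I.
by have := L x y xu yu xy; case: ifP; lia.
Qed.

Definition prankE w u : prank w u = \max_(x | x != u) rk w u x := erefl.

Lemma rk_le_prank w u x : rk w u x <= prank w u.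
Proof.
case: (eqVneq x u) => [->|xu]; first by rewrite rk_diag.
exact: (@leq_bigmax_cond _ (fun x => x != u) (fun x => rk w u x)).
Qed.

Lemma prank_lt w u : prank w u < n.
Proof.
have n0 : 0 < n by apply: leq_ltn_trans (ltn_ord u).
suff : prank w u <= n.-1 by lia.
by apply/bigmax_leqP => x _; have := rk_lt w u x; rewrite /rk; lia.
Qed.

Lemma rk_gt0 w x y : x != y -> 0 < rk w x y.
Proof.
move=> xy; have n0 : 0 < n by apply: leq_ltn_trans (ltn_ord x).
have /eqP := nclasses_rk w (k := 1) n0.
rewrite /nclasses => /cards1P[X /setP XE].
have X1 z : [set t in setT | lvl (rk w) 1 z t] = X.
  by apply/eqP; rewrite -in_set1 -XE imset_f.
have /setP/(_ y) := etrans (X1 x) (esym (X1 y)).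
by rewrite !inE /lvl eqxx (negbTE xy).
Qed.

Hypothesis n1 : 1 < n.

Lemma exists_other u : exists a : 'I_n, a != u.
Proof.
have /card_gt0P[a] : 0 < #|[set~ u]| by rewrite card_setC1; lia.
by rewrite !inE; exists a.
Qed.

Lemma prank_gt0 w u : 0 < prank w u.
Proof.
have [a au] := exists_other u; apply: leq_trans (rk_le_prank w u a).
by apply: rk_gt0; rewrite eq_sym.
Qed.

Lemma prank_witness w u : exists2 a, a != u & rk w u a = prank w u.
Proof.
have [a0 a0u] := exists_other u.
have c0 : 0 < #|[pred x | x != u]| by apply/card_gt0P; exists a0; rewrite !inE.
have [a au E] := eq_bigmax_cond (fun x => rk w u x) c0.
by exists a => //; rewrite prankE E.
Qed.

Definition delr w u (x y : 'I_n) : nat :=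
  if rk w x y < prank w u then rk w x y else (rk w x y).-1.

Lemma rk_neq_prank w u : {in [set~ u] &, forall x y, x != y -> rk w x y != prank w u}.
Proof.
set m := prank w u; have m0 := prank_gt0 w u; have mn := prank_lt w u.
have [a au ra] := prank_witness w u.
have e1 : nclasses (lvl (rk w) m) [set~ u] = m.
  rewrite -(@nclasses_mate _ (lvl (rk w) m) u a) //; last by rewrite /lvl ra leqnn orbT.
    by rewrite nclasses_rk //; lia.
  exact: lvl_rk_equiv.
have e2 : nclasses (lvl (rk w) m.+1) [set~ u] = m.
  apply: succn_inj; rewrite -nclasses_alone ?nclasses_rk //.
    exact: lvl_rk_equiv.
  by move=> x; rewrite /lvl; case: eqVneq => [->//|_] /=; have := rk_le_prank w u x; rewrite -/m; lia.
have eP k : 0 < k -> {in [set~ u] & &, equivalence_rel (lvl (rk w) k)}.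
  by move=> k0 x y z _ _ _; exact: (lvl_rk_equiv w k0 x y z).
have H := @nclasses_sub_eq _ _ _ _ (eP m.+1 (ltn0Sn _)) (eP m m0).
have {}H := H _ (etrans e2 (esym e1)).
move=> x y xV yV xy; apply/eqP => E.
have /H/(_ x y xV yV) : {in [set~ u] &, forall x y, lvl (rk w) m.+1 x y -> lvl (rk w) m x y}.
  by move=> s t _ _; rewrite /lvl; case: eqP => //= _; lia.
by rewrite /lvl (negbTE xy) /= E leqnn ltnn.
Qed.

Lemma lvl_delr w u k : 0 < k -> {in [set~ u] &, lvl (delr w u) k =2
   lvl (rk w) (if k < prank w u then k else k.+1)}.
Proof.
move=> k0 x y xV yV; rewrite /lvl /delr /=; case: eqVneq => //= xy.
have := rk_neq_prank w xV yV xy; have := prank_gt0 w u.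
by case: ifP; case: ifP => ? ? ? ?; lia.
Qed.

Lemma redtree_delr w u : redtree u (delr w u).
Proof.
split=> [x y _ _|k k0 x y z xV yV zV|k kn]; first by rewrite /delr rkC.
- by rewrite !lvl_delr //; apply: lvl_rk_equiv; case: ifP.
have k0 : 0 < k by lia.
rewrite (eq_nclasses (lvl_delr _ k0)).
have eP j : 0 < j -> equivalence_rel (lvl (rk w) j) by apply: lvl_rk_equiv.
have [a au ra] := prank_witness w u.
case: ifP => kp.
  rewrite -(@nclasses_mate _ _ u a) ?nclasses_rk //; first by lia.
    exact: eP.
  by rewrite /lvl ra ltnW ?orbT.
have ua x : lvl (rk w) k.+1 u x -> x = u.
  by rewrite /lvl; case: eqVneq => [->//|_] /=; have := rk_le_prank w u x; lia.
by apply: succn_inj; rewrite -(nclasses_alone (eP _ (ltn0Sn k)) ua) nclasses_rk //; lia.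
Qed.

Definition insT w d u m a : rtree n :=
  insubd w [ffun xy : 'I_n * 'I_n => insubd u (insr d u m a xy.1 xy.2)].

Lemma rk_insubd w (c : {ffun 'I_n * 'I_n -> 'I_n}) d u m a :
  redtree u d -> a != u -> 0 < m < n ->
  (forall x y, val (c (x, y)) = insr d u m a x y) ->
  rk (insubd w c) =2 insr d u m a.
Proof.
move=> rd au m0 cE x y; rewrite /rk val_insubd.
by rewrite (is_rtree_insr rd au m0 cE) cE.
Qed.

Lemma rk_insT w d u m a : redtree u d -> a != u -> 0 < m < n ->
  rk (insT w d u m a) =2 insr d u m a.
Proof.
move=> rd au m0; apply: rk_insubd => // x y.
by rewrite ffunE val_insubd insr_lt.
Qed.

Lemma rk_moran w u v : v != u ->
  rk (moran_tree w u v) =2 insr (delr w u) u n.-1 v.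
Proof.
move=> vu; have rd := redtree_delr w u; have n0 : 0 < n.-1 < n by lia.
apply: rk_insubd => // x y.
rewrite ffunE val_insubd /=.
set L := (X in if X < n then X else _).
suff -> : L = insr (delr w u) u n.-1 v x y by rewrite insr_lt.
have L2 s t : s != u -> t != u -> s != t -> delr w u s t < n.-1.
  by move=> su tu st; apply: (red_lt rd) => //; rewrite !inE.
rewrite /L /insr /lvl /=; case: (eqVneq x y) => // xy.
case: (eqVneq x u) => [xu|xu].
  rewrite [v == y]eq_sym; case: (eqVneq y v) => //= yv.
  by rewrite [n.-1 <= _]leqNgt L2 //; rewrite ?[v == y]eq_sym // -xu eq_sym.
case: (eqVneq y u) => [yu|yu].
  rewrite [v == x]eq_sym; case: (eqVneq x v) => //= xv.
  by rewrite [n.-1 <= _]leqNgt L2 //; rewrite ?[v == x]eq_sym.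
by rewrite -[if _ then _ else _]/(delr w u x y) -/(delr w u x y) L2.
Qed.

Lemma prank_insr w' d u m a : redtree u d -> a != u -> 0 < m < n ->
  (rk w' =2 insr d u m a) -> prank w' u = m.
Proof.
move=> rd au m0 wE; apply/eqP; rewrite eqn_leq; apply/andP; split.
  apply/bigmax_leqP => x xu; rewrite -[val _]/(rk w' u x) wE /insr eqxx eq_sym (negbTE xu).
  by case: ifP => // /norP[_]; lia.
suff <- : rk w' u a = m by apply: rk_le_prank.
by rewrite wE /insr eqxx eq_sym (negbTE au) /lvl eqxx.
Qed.

Lemma delr_insr w' d u m a : redtree u d -> a != u -> 0 < m < n ->
  (rk w' =2 insr d u m a) ->
  {in [set~ u] &, forall x y, x != y -> delr w' u x y = d x y}.
Proof.
move=> rd au m0 wE x y; rewrite !inE => xu yu xy.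
rewrite /delr (prank_insr rd au m0 wE) wE /insr (negbTE xy) (negbTE xu) (negbTE yu).
by case: (ltnP (d x y) m) => h; [rewrite h | case: ifP => //=; lia].
Qed.

Lemma eq_insr d d' u m a : a != u ->
  {in [set~ u] &, forall x y, x != y -> d x y = d' x y} ->
  insr d u m a =2 insr d' u m a.
Proof.
move=> au dd x y; rewrite /insr /lvl /=; case: eqVneq => // xy.
have I (z : 'I_n) : z != u -> (if (a == z) || (m <= d a z) then m else d a z) =
   (if (a == z) || (m <= d' a z) then m else d' a z).
  by move=> zu; case: eqVneq => //= az; rewrite dd ?inE.
case: eqVneq => [xu|xu]; first by apply: I; rewrite -xu eq_sym.
case: eqVneq => [yu|yu]; first by apply: I.
by rewrite dd ?inE.
Qed.

Lemma rk_delr_insr w u a : a != u -> rk w u a = prank w u ->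
  rk w =2 insr (delr w u) u (prank w u) a.
Proof.
move=> au ra x y; set m := prank w u; have m0 : 0 < m := prank_gt0 w u.
rewrite /insr; case: eqVneq => [<-|xy]; first by rewrite rk_diag.
have I z : z != u -> rk w u z = if lvl (delr w u) m a z then m else delr w u a z.
  move=> zu; rewrite lvl_delr ?inE // ltnn.
  have lvlm := (lvl_rk_equiv w m0 u a z).2; have zm := rk_le_prank w u z.
  rewrite /lvl eq_sym (negbTE au) [u == z]eq_sym (negbTE zu) /= ra leqnn in lvlm.
  have {}lvlm := lvlm isT.
  rewrite {1}/lvl; case: (eqVneq a z) => [<-|az] /=; first by rewrite ra.
  rewrite (negbTE az) /= in lvlm.
  have := @rk_neq_prank w u a z; rewrite !inE => /(_ au zu az) azm.
  case: ifP => h; first by apply/eqP; rewrite eqn_leq zm lvlm; apply: ltnW.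
  have azl : rk w a z < m by rewrite -/m in azm; lia.
  rewrite /delr azl; have uzl : rk w u z < m by rewrite ltnNge lvlm -ltnNge.
  have K k : 0 < k <= m -> (k <= rk w u z) = (k <= rk w a z).
    move=> /andP[k0 km]; have := (lvl_rk_equiv w k0 u a z).2.
    rewrite /lvl eq_sym (negbTE au) [u == z]eq_sym (negbTE zu) (negbTE az) /= ra -/m km.
    by move=> /(_ isT).
  have az0 := rk_gt0 w az; have uz0 : 0 < rk w u z by apply: rk_gt0; rewrite eq_sym.
  by apply/eqP; rewrite eqn_leq -K ?leqnn ?K ?leqnn //; lia.
case: eqVneq => [xu|xu]; first by rewrite xu I // -xu eq_sym.
case: eqVneq => [yu|yu]; first by rewrite yu rkC I.
have := @rk_neq_prank w u x y; rewrite !inE => /(_ xu yu xy).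
by rewrite /delr -/m; case: (ltnP (rk w x y) m) => h1 h2; [rewrite h1|case: ifP; lia].
Qed.


Lemma insr_eqE d u m a b : redtree u d -> a != u -> b != u -> 0 < m ->
  lvl d m a b -> insr d u m a =2 insr d u m b.
Proof.
move=> rd au bu m0 ab x y; rewrite /insr; case: eqVneq => // xy.
have I (z : 'I_n) : z != u ->
    (if lvl d m a z then m else d a z) = (if lvl d m b z then m else d b z).
  move=> zu; have V : [/\ a \in [set~ u], b \in [set~ u] & z \in [set~ u]] by rewrite !inE.
  case: V => aV bV zV.
  rewrite -((red_equiv rd m0 aV bV zV).2 ab); case: ifP => // /negbT az.
  have bz : ~~ lvl d m b z by rewrite -((red_equiv rd m0 aV bV zV).2 ab).
  have K k : 0 < k <= m -> (k <= d a z) = (k <= d b z).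
    move=> /andP[k0 km]; have := (red_equiv rd k0 aV bV zV).2.
    move: az bz; rewrite /lvl => /norP[/negbTE-> _] /norP[/negbTE-> _] /=; apply.
    by move: ab; rewrite /lvl => /orP[->//|h]; apply/orP; right; lia.
  move: az bz; rewrite /lvl => /norP[_ az] /norP[_ bz].
  have K1 := K (d a z); have K2 := K (d b z); lia.
case: eqVneq => [xu|xu]; first by apply: I; rewrite -xu eq_sym.
by case: eqVneq => [yu|yu]; first by apply: I.
Qed.

Lemma rk_moran_uv w u v : v != u -> rk (moran_tree w u v) u v = n.-1.
Proof. by move=> vu; rewrite rk_moran // /insr eq_sym (negbTE vu) eqxx /lvl eqxx. Qed.

Lemma rk_moran_ux w u v x : v != u -> x != u -> x != v ->
  rk (moran_tree w u v) u x = delr w u v x.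
Proof.
move=> vu xu xv; rewrite rk_moran // /insr [u == x]eq_sym (negbTE xu) eqxx.
rewrite /lvl [v == x]eq_sym (negbTE xv) /= leqNgt.
by rewrite (red_lt (redtree_delr w u)) // ?inE // eq_sym.
Qed.

Lemma rk_moran_xy w u v x y : v != u -> x != u -> y != u -> x != y ->
  rk (moran_tree w u v) x y = delr w u x y.
Proof.
move=> vu xu yu xy; rewrite rk_moran // /insr (negbTE xy) (negbTE xu) (negbTE yu).
by rewrite (red_lt (redtree_delr w u)) // ?inE.
Qed.

Lemma card_moran_fiber w' u v m : v != u -> rk w' u v = n.-1 -> 0 < m < n ->
  #|[set w | (moran_tree w u v == w') && (prank w u == m)]| = m.
Proof.
move=> vu ruv m0; set d := delr w' u; have rd : redtree u d := redtree_delr w' u.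
have n0 : 0 < n.-1 < n by lia.
have pw' : prank w' u = n.-1.
  by have := rk_le_prank w' u v; have := prank_lt w' u; lia.
have w'E : rk w' =2 insr d u n.-1 v by rewrite -pw'; apply: rk_delr_insr; rewrite ?pw'.
have dE : d = delr w' u by []; clearbody d.
have -> : [set w | (moran_tree w u v == w') && (prank w u == m)] =
          (fun a => insT w' d u m a) @: [set~ u].
  apply/setP => w; rewrite inE; apply/andP/imsetP.
    move=> [/eqP mw /eqP pw]; have [a au ra] := prank_witness w u.
    exists a; rewrite ?inE //; apply: rk_inj => x y; rewrite rk_insT //.
    rewrite (rk_delr_insr au ra) pw; apply: eq_insr => // s t sV tV st.
    rewrite dE -mw; apply/esym/(delr_insr (redtree_delr w u) vu n0 (rk_moran w vu)) => //.
  move=> [a]; rewrite !inE => au ->; have E := rk_insT w' rd au m0.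
  split; apply/eqP; last exact: prank_insr E.
  apply: rk_inj => x y; rewrite rk_moran // w'E; apply: eq_insr => // s t sV tV st.
  exact: delr_insr E _ _ _ _ _.
rewrite -[RHS](red_nclasses rd m0); apply/esym/nclasses_imset => a b.
rewrite !inE => au bu; have m00 : 0 < m by lia.
apply/eqP/idP => [E|ab]; last first.
  by apply: rk_inj => x y; rewrite !rk_insT //; exact: insr_eqE.
have := rk_insT w' rd au m0 u b; rewrite E rk_insT // /insr eq_sym (negbTE bu) eqxx.
by rewrite {1}/lvl eqxx /=; case: ifP => // /norP[_ h] h'; lia.
Qed.

Lemma card_moran_fiber0 w' u v m : v != u -> rk w' u v != n.-1 ->
  #|[set w | (moran_tree w u v == w') && (prank w u == m)]| = 0.
Proof.
move=> vu ruv; apply: eq_card0 => w; rewrite inE; apply/negbTE/negP.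
by move=> /andP[/eqP mw _]; rewrite -mw rk_moran_uv // eqxx in ruv.
Qed.

Lemma cherryP w : exists u v, [/\ v != u, rk w u v = n.-1 &
  forall x y, y != x -> rk w x y = n.-1 -> (x, y) = (u, v) \/ (x, y) = (v, u)].
Proof.
have /existsP[u /existsP[v /andP[vu /eqP ruv]]] :
    [exists u, exists v, (v != u) && (rk w u v == n.-1)].
  apply: contraT => h.
  have E : {in [set: 'I_n] &, forall x y, (id x == id y) = lvl (rk w) n.-1 x y}.
    move=> x y _ _; rewrite /lvl; case: eqVneq => //= xy; apply/esym/negbTE/negP => h1.
    move/negP: h; apply; apply/existsP; exists x; apply/existsP; exists y.
    by rewrite eq_sym xy /=; have := rk_lt w x y; lia.
  have := nclasses_imset E; rewrite nclasses_rk; last by lia.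
  by rewrite imset_id cardsT card_ord => nn; exfalso; lia.
have P a b x y : b != a -> rk w a b = n.-1 -> y != x -> rk w x y = n.-1 -> (x == a) || (y == a).
  move=> ba rab yx rxy; have pa : prank w a = n.-1.
    by have := rk_le_prank w a b; have := prank_lt w a; lia.
  apply/negPn/negP => /norP[xa ya]; have := @rk_neq_prank w a x y; rewrite !inE pa rxy eqxx.
  by move=> /(_ xa ya); rewrite eq_sym yx => /(_ isT).
exists u, v; split=> // x y yx rxy.
have uv : u != v by rewrite eq_sym.
have h1 := P u v x y vu ruv yx rxy.
have h2 : (x == v) || (y == v) by apply: (P v u) => //; rewrite rkC.
case/orP: h1 => /eqP E1; case/orP: h2 => /eqP E2; rewrite ?E1 ?E2; auto.
- by move: vu; rewrite -E1 -E2 eqxx.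
- by move: vu; rewrite -E1 -E2 eqxx.
Qed.

Lemma card_cherry w :
  #|[set p : 'I_n * 'I_n | (p.2 != p.1) && (rk w p.1 p.2 == n.-1)]| = 2.
Proof.
have [u [v [vu ruv H]]] := cherryP w.
have -> : [set p : 'I_n * 'I_n | (p.2 != p.1) && (rk w p.1 p.2 == n.-1)] =
    [set (u, v); (v, u)].
  apply/setP => -[x y]; rewrite !inE /=; apply/andP/idP.
    by move=> [yx /eqP rxy]; case: (H x y yx rxy) => ->; rewrite eqxx ?orbT.
  by case/orP => /eqP[-> ->]; rewrite ?vu ?ruv ?eqxx // eq_sym vu rkC ruv eqxx.
by rewrite cards2; case: eqP => // -[uv _]; rewrite uv eqxx in vu.
Qed.

Lemma card_moran_preim w' (m : 'I_n) :
  #|[set p : rtree n * ('I_n * 'I_n) | (p.2.2 != p.2.1) &&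
      ((moran_tree p.1 p.2.1 p.2.2, prank p.1 p.2.1) == (w', val m))]| = m.*2.
Proof.
rewrite -sum1_card (eq_bigl _ _ (fun p => in_set _ p)).
transitivity (\sum_(q : 'I_n * 'I_n | q.2 != q.1)
   \sum_(w | (moran_tree w q.1 q.2 == w') && (prank w q.1 == m)) 1).
  rewrite pair_big_dep /= [RHS](reindex (fun p : rtree n * ('I_n * 'I_n) => (p.2, p.1))) /=.
    by apply: eq_bigl => -[w [x y]].
  by exists (fun p => (p.2, p.1)) => -[].
have F q : q.2 != q.1 -> \sum_(w | (moran_tree w q.1 q.2 == w') && (prank w q.1 == m)) 1
   = if rk w' q.1 q.2 == n.-1 then val m else 0.
  move=> q12; rewrite -(eq_bigl _ _ (fun p => in_set _ p)) sum1_card.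
  case: eqP => [h|/eqP h]; last exact: card_moran_fiber0.
  case: (posnP m) => m0; last by apply: card_moran_fiber; rewrite // m0 ltn_ord.
  rewrite (_ : val m = 0) //; apply: eq_card0 => w; rewrite inE m0; have := prank_gt0 w q.1.
  by case: (prank w q.1) => // k _; rewrite andbF.
rewrite (eq_bigr _ F) -big_mkcondr /= sum_nat_const mulnC -muln2; congr (_ * _).
rewrite -[RHS](card_cherry w'); apply: eq_card => q; by rewrite !inE.
Qed.

Lemma moran_reindex (V : nmodType) (F : rtree n -> nat -> V) :
  (\sum_w \sum_(u : 'I_n) \sum_(v : 'I_n | v != u) F (moran_tree w u v) (prank w u) =
   \sum_w \sum_(m < n) F w m *+ (m.*2))%R.
Proof.
under eq_bigr do rewrite pair_big_dep /=.
rewrite !pair_big_dep /=.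
pose g (p : rtree n * ('I_n * 'I_n)) : rtree n * 'I_n :=
  (moran_tree p.1 p.2.1 p.2.2, Ordinal (prank_lt p.1 p.2.1)).
rewrite (partition_big g predT) //=; apply: eq_bigr => -[w m] _ /=.
rewrite -(card_moran_preim w m) -sumr_const.
apply: eq_big => [p|p /andP[_ /eqP[<- <-]] //].
by rewrite inE; congr (_ && _); rewrite !xpair_eqE -val_eqE.
Qed.

Lemma card_rtree_cherry u v : v != u ->
  #|{: rtree n}| = ('C(n, 2) * #|[set w | rk w u v == n.-1]|)%N.
Proof.
move=> vu; rewrite -[LHS]sum1_card.
pose g w : rtree n * 'I_n := (moran_tree w u v, Ordinal (prank_lt w u)).
rewrite (partition_big g (fun p => rk p.1 u v == n.-1)) /=; last first.
  by move=> w _; rewrite rk_moran_uv.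
transitivity (\sum_(p : rtree n * 'I_n | rk p.1 u v == n.-1) val p.2).
  apply: eq_bigr => -[w m] /= /eqP rw.
  rewrite (eq_bigl (fun w0 => w0 \in [set w0 | (moran_tree w0 u v == w) && (prank w0 u == m)])); last first.
    by move=> w0; rewrite inE xpair_eqE -val_eqE.
  rewrite sum1_card; case: (posnP m) => m0; last by rewrite card_moran_fiber // m0 ltn_ord.
  rewrite [RHS]m0; apply: eq_card0 => w0; rewrite inE m0; have := prank_gt0 w0 u.
  by case: (prank w0 u) => // k _; rewrite andbF.
rewrite (eq_bigl (fun p : rtree n * 'I_n => (rk p.1 u v == n.-1) && predT p.2)); last first.
  by move=> p; rewrite andbT.
rewrite -(pair_big (fun w => rk w u v == n.-1) predT (fun _ m => val m)) /=.
rewrite sum_nat_const mulnC; congr (_ * _)%N; last by apply: eq_card => w; rewrite inE.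
by rewrite -bin2_sum big_mkord.
Qed.

(* The leaves [0..i] carry the [i] latest nodes, and [w] and [w'] agree on them. *)
Definition recent i w w' :=
  [/\ forall x y : 'I_n, x <= i -> y <= i -> x != y -> rk w x y = rk w' x y,
      forall x y : 'I_n, x <= i -> y <= i -> x != y -> n.-1 - i < rk w x y,
      forall x y : 'I_n, i < x -> rk w x y <= n.-1 - i &
      forall x y : 'I_n, i < x -> rk w' x y <= n.-1 - i].

Lemma recent0 w w' : recent 0 w w'.
Proof.
split=> x y; rewrite ?leqn0 ?subn0.
- by move=> /eqP x0 /eqP y0 /eqP[]; apply/val_inj; rewrite /= x0 y0.
- by move=> /eqP x0 /eqP y0 /eqP[]; apply/val_inj; rewrite /= x0 y0.
- by move=> _; have := rk_lt w x y; lia.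
- by move=> _; have := rk_lt w' x y; lia.
Qed.

Lemma recent_eq i w w' : n.-1 <= i -> recent i w w' -> w = w'.
Proof.
move=> ni [H _ _ _]; apply: rk_inj => x y; case: (eqVneq x y) => [->|xy].
  by rewrite !rk_diag.
by apply: H => //; have := ltn_ord x; have := ltn_ord y; lia.
Qed.

Lemma recent_prank i w w' (u : 'I_n) : recent i w w' -> i < u ->
  prank w u <= n.-1 - i /\ prank w' u <= n.-1 - i.
Proof. by move=> [_ _ h h'] iu; split; apply/bigmax_leqP => x _; [exact: h|exact: h']. Qed.

Lemma recent_moran i w w' (u v : 'I_n) : val u = i.+1 -> val v = 0 ->
  recent i w w' -> recent i.+1 (moran_tree w u v) (moran_tree w' u v).
Proof.
move=> ui v0 rec; have iu : i < u by rewrite ui.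
have [pw pw'] := recent_prank rec iu; case: rec => H1 H2 H3 H4.
have vu : v != u by rewrite -val_eqE /= ui v0.
have uv : u != v by rewrite eq_sym.
have un := ltn_ord u.
have lei (x : 'I_n) : x <= i.+1 -> x != u -> x <= i.
  by rewrite -val_eqE; move: ui => /= ->; lia.
have D1 (x y : 'I_n) : x <= i -> y <= i -> x != y ->
    delr w u x y = delr w' u x y /\ n.-1 - i.+1 < delr w u x y.
  move=> xi yi xy; have h1 := H1 x y xi yi xy; have h2 := H2 x y xi yi xy.
  by rewrite /delr -h1; do 2 case: ifP; lia.
have D2 w0 (x y : 'I_n) : prank w0 u <= n.-1 - i -> (forall x y : 'I_n, i < x -> rk w0 x y <= n.-1 - i) ->
    i.+1 < x -> y != u -> x != y -> delr w0 u x y <= n.-1 - i.+1.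
  move=> p0 h0 xi yu xy; have xu : x != u by rewrite -val_eqE; move: ui => /= ->; lia.
  have := @rk_neq_prank w0 u x y; rewrite !inE => /(_ xu yu xy).
  by have := h0 x y; rewrite /delr; case: ifP; lia.
have D3 w0 (x y : 'I_n) : prank w0 u <= n.-1 - i -> (forall x y : 'I_n, i < x -> rk w0 x y <= n.-1 - i) ->
    i.+1 < x -> rk (moran_tree w0 u v) x y <= n.-1 - i.+1.
  move=> p0 h0 xi; have xu : x != u by rewrite -val_eqE; move: ui => /= ->; lia.
  have xv : x != v by rewrite -val_eqE; move: v0 => /= ->; lia.
  case: (eqVneq x y) => [->|xy]; first by rewrite rk_diag.
  case: (eqVneq y u) => [->|yu]; last by rewrite rk_moran_xy // D2.
  by rewrite rkC rk_moran_ux // (redC (redtree_delr w0 u)) ?inE // D2.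
split=> [x y xi yi xy|x y xi yi xy|x y xi|x y xi]; last 2 first.
- exact: (D3 w x y pw H3 xi).
- exact: (D3 w' x y pw' H4 xi).
- case: (eqVneq x u) => xu; last case: (eqVneq y u) => yu.
  + rewrite xu; case: (eqVneq y v) => [->|yv]; first by rewrite !rk_moran_uv.
    have yu : y != u by rewrite -xu eq_sym.
    by rewrite !rk_moran_ux //; apply: (D1 _ _ _ _ _).1; rewrite ?v0 ?lei // eq_sym.
  + rewrite yu ![rk _ x u]rkC; case: (eqVneq x v) => [->|xv]; first by rewrite !rk_moran_uv.
    by rewrite !rk_moran_ux //; apply: (D1 _ _ _ _ _).1; rewrite ?v0 ?lei // eq_sym.
  + by rewrite !rk_moran_xy //; apply: (D1 _ _ _ _ _).1; rewrite ?lei.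
- case: (eqVneq x u) => xu; last case: (eqVneq y u) => yu.
  + rewrite xu; case: (eqVneq y v) => [->|yv]; first by rewrite !rk_moran_uv //; lia.
    have yu : y != u by rewrite -xu eq_sym.
    by rewrite !rk_moran_ux //; apply: (D1 _ _ _ _ _).2; rewrite ?v0 ?lei // eq_sym.
  + rewrite yu ![rk _ x u]rkC; case: (eqVneq x v) => [->|xv]; first by rewrite !rk_moran_uv //; lia.
    by rewrite !rk_moran_ux //; apply: (D1 _ _ _ _ _).2; rewrite ?v0 ?lei // eq_sym.
  + by rewrite !rk_moran_xy //; apply: (D1 _ _ _ _ _).2; rewrite ?lei.
Qed.

End RankedTrees.

Section CardRtree.
Variable k : nat.
Notation wide := (widen_ord (leqnSn k.+1)).

Lemma wide_inord (x : 'I_k.+2) : x != ord_max -> wide (inord x) = x.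
Proof.
by rewrite -val_eqE /= => h; apply/val_inj => /=; rewrite inordK //; have := ltn_ord x; lia.
Qed.

Lemma wide_neq (x : 'I_k.+1) : wide x != ord_max.
Proof. by rewrite -val_eqE /=; have := ltn_ord x; lia. Qed.

Lemma inord_wide (x : 'I_k.+1) : inord (wide x) = x :> 'I_k.+1.
Proof. by apply/val_inj; rewrite /= inordK. Qed.

Definition widr (w : rtree k.+1) (x y : 'I_k.+2) : nat := rk w (inord x) (inord y).

Lemma redtree_widr w : redtree ord_max (widr w).
Proof.
have L j : {in [set~ ord_max] &, lvl (widr w) j =2
    (fun x y => lvl (rk w) j (inord x) (inord y))}.
  move=> x y; rewrite !inE => xV yV; rewrite /lvl; congr (_ || _).
  by apply/eqP/eqP => [->//|/(congr1 wide)]; rewrite !wide_inord.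
split=> [x y _ _|j j0 x y z xV yV zV|j j0]; first by rewrite /widr rkC.
  by rewrite !L //; exact: lvl_rk_equiv.
have j00 : 0 < j by lia.
have jk : 0 < j <= k.+1 by lia.
rewrite (eq_nclasses (L j)) -[RHS](nclasses_rk w jk).
pose f (x : 'I_k.+1) := [set y in setT | lvl (rk w) j x y].
have e' : {in [set: 'I_k.+1] & &, equivalence_rel (lvl (rk w) j)}.
  by move=> x y z _ _ _; exact: (lvl_rk_equiv w j00 x y z).
rewrite (@nclasses_imset _ _ _ _ (fun x : 'I_k.+2 => f (inord x))); last first.
  by move=> x y _ _; rewrite /f (class_eqE e') ?inE.
rewrite /nclasses -/f; congr (#|pred_of_set _|).
apply/setP => X; apply/imsetP/imsetP => -[x _ ->]; first by exists (inord x).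
by exists (wide x); rewrite ?inord_wide // !inE wide_neq.
Qed.

Definition rcut (w : rtree k.+2) : {ffun 'I_k.+1 * 'I_k.+1 -> 'I_k.+1} :=
  [ffun xy => inord (rk w (wide xy.1) (wide xy.2))].

Lemma rcutE w x y : rk w ord_max ord0 = k.+1 ->
  val (rcut w (x, y)) = rk w (wide x) (wide y).
Proof.
move=> rw; rewrite ffunE /= inordK //.
case: (eqVneq x y) => [->|xy]; first by rewrite rk_diag.
have pw : prank w ord_max = k.+1.
  by have := rk_le_prank w ord_max ord0; have := prank_lt w ord_max; lia.
have := @rk_neq_prank k.+2 isT w ord_max (wide x) (wide y).
rewrite !inE !wide_neq pw => /(_ isT isT).
have -> : wide x != wide y by apply: contraNneq xy => /(congr1 val) /= ?; apply/eqP/val_inj.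
by move=> /(_ isT); have := rk_lt w (wide x) (wide y); lia.
Qed.

Lemma is_rtree_rcut w : rk w ord_max ord0 = k.+1 -> is_rtree (rcut w).
Proof.
move=> rw; have pw : prank w ord_max = k.+1.
  by have := rk_le_prank w ord_max ord0; have := prank_lt w ord_max; lia.
have inj : injective wide by move=> x y /(congr1 val) /= ?; exact/val_inj.
have L j : lvl (fun x y => val (rcut w (x, y))) j =2
    (fun x y => lvl (rk w) j (wide x) (wide y)).
  by move=> x y; rewrite /lvl rcutE // (inj_eq inj).
apply: is_rtree_nclasses => [x|x y|j jk|j jk]; rewrite ?rcutE ?rk_diag //.
- by rewrite rkC.
- have j0 : 0 < j by lia.
  by move=> x y z; rewrite !L; exact: lvl_rk_equiv.
have j0 : 0 < j by lia.
have e1 : equivalence_rel (lvl (rk w) j) by exact: lvl_rk_equiv.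
have e' : {in [set: 'I_k.+2] & &, equivalence_rel (lvl (rk w) j)}.
  by move=> x y z _ _ _; exact: (e1 x y z).
have m0 : ord0 != ord_max :> 'I_k.+2 by [].
have jk2 : 0 < j <= k.+2 by lia.
rewrite -[RHS](nclasses_rk w jk2).
rewrite [RHS](nclasses_mate e1 m0); last first.
  by rewrite /lvl rw; apply/orP; right; lia.
pose f (x : 'I_k.+2) := [set y in setT | lvl (rk w) j x y].
rewrite (@nclasses_imset _ _ _ _ (fun x : 'I_k.+1 => f (wide x))); last first.
  by move=> x y _ _; rewrite L /f (class_eqE e') ?inE.
rewrite (@nclasses_imset _ _ _ _ f); last first.
  by move=> x y _ _; rewrite /f (class_eqE e') ?inE.
congr (#|pred_of_set _|); apply/setP => X; apply/imsetP/imsetP => -[x xV ->].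
  by exists (wide x); rewrite // !inE wide_neq.
by exists (inord x); rewrite // wide_inord //; rewrite !inE in xV.
Qed.

Lemma card_cherry_rtree :
  #|[set w : rtree k.+2 | rk w ord_max ord0 == k.+1]| = #|{: rtree k.+1}|.
Proof.
have n1 : 1 < k.+2 by [].
have m0 : ord0 != ord_max :> 'I_k.+2 by [].
have k0 : 0 < k.+1 < k.+2 by lia.
pose w0 : rtree k.+2 := exist (fun c => is_rtree c) _ (cater_ok k.+2).
pose f (w : rtree k.+1) := insT w0 (widr w) ord_max k.+1 ord0.
have fE w : rk (f w) =2 insr (widr w) ord_max k.+1 ord0.
  by apply: rk_insT => //; exact: redtree_widr.
have fw w x y : rk (f w) (wide x) (wide y) = rk w x y.
  rewrite fE /insr (negbTE (wide_neq x)) (negbTE (wide_neq y)) /widr !inord_wide.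
  case: eqVneq => [/(congr1 val) /= xy|_].
    by rewrite (val_inj xy : x = y) rk_diag.
  by rewrite rk_lt.
have -> : [set w : rtree k.+2 | rk w ord_max ord0 == k.+1] = f @: setT.
  apply/setP => w; rewrite inE; apply/eqP/imsetP => [rw|[w' _ ->]]; last first.
    by rewrite fE /insr /lvl !eqxx eq_sym (negbTE m0).
  pose w' : rtree k.+1 := exist (fun c => is_rtree c) _ (is_rtree_rcut rw).
  have pw : prank w ord_max = k.+1.
    by have := rk_le_prank w ord_max ord0; have := prank_lt w ord_max; lia.
  exists w' => //; apply: rk_inj => x y; rewrite fE.
  rewrite (@rk_delr_insr _ n1 w ord_max ord0) // ?pw //.
  apply: eq_insr => // s t sV tV st.
  have := @rk_neq_prank _ n1 w ord_max s t sV tV st.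
  rewrite /widr -[rk w' _ _]/(val (rcut w (inord s, inord t))) rcutE // pw.
  rewrite !inE in sV tV; rewrite !wide_inord // /delr pw.
  by have := rk_lt w s t; case: ifP; lia.
rewrite card_imset ?cardsT // => w w' ff; apply: rk_inj => x y.
by rewrite -!fw ff.
Qed.

End CardRtree.

Lemma card_rtree n : 0 < n -> #|{: rtree n}| = \prod_(j < n.-1) 'C(j.+2, 2).
Proof.
case: n => // n _; elim: n => [|n IH].
  rewrite big_ord0; apply/eqP; rewrite eqn_leq; apply/andP; split; last first.
    by apply/card_gt0P; exists (exist (fun c => is_rtree c) _ (cater_ok 1)).
  apply/card_le1_eqP => w w' _ _; apply: rk_inj => x y.
  by have := rk_lt w x y; have := rk_lt w' x y; lia.
rewrite /= in IH; rewrite /= big_ord_recr /= -IH mulnC.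
by rewrite (@card_rtree_cherry n.+2 isT ord_max ord0) // card_cherry_rtree.
Qed.

From mathcomp Require Import all_classical all_reals all_analysis.
From mathcomp Require Import measurable_realfun ring lra.
Import Order.TTheory GRing.Theory Num.Theory.
Import numFieldNormedType.Exports.
Local Open Scope classical_set_scope.
Local Open Scope ring_scope.

Section LineIntegrals.
Context {R : realType}.
Notation leb := (@lebesgue_measure R).
Local Open Scope ereal_scope.
Implicit Types f : R -> \bar R.

Lemma measurable_lint d (T : measurableType d) (f : T * R -> \bar R) :
  measurable_fun setT f -> (forall x, 0 <= f x) ->
  measurable_fun setT (fun t => \int[leb]_r f (t, r)).
Proof.
move=> mf f0.
exact: (@measurable_fun_fubini_tonelli_F _ _ T (measurableTypeR R) R leb f mf f0).
Qed.

Lemma fubini_line (f : R * R -> \bar R) :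
  measurable_fun setT f -> (forall x, 0 <= f x) ->
  \int[leb]_x \int[leb]_y f (x, y) = \int[leb]_y \int[leb]_x f (x, y).
Proof.
move=> mf f0.
exact: (@fubini_tonelli _ _ (measurableTypeR R) (measurableTypeR R) R leb leb f mf f0).
Qed.

Lemma fubini_leb d (T : measurableType d) (m : {sigma_finite_measure set T -> \bar R})
    (f : T * R -> \bar R) :
  measurable_fun setT f -> (forall x, 0 <= f x) ->
  \int[m]_x \int[leb]_y f (x, y) = \int[leb]_y \int[m]_x f (x, y).
Proof.
move=> mf f0.
exact: (@fubini_tonelli _ _ T (measurableTypeR R) R m leb f mf f0).
Qed.

Lemma lebesgue_shift (a : R) f : measurable_fun setT f -> (forall x, 0 <= f x) ->
  \int[leb]_x f (x + a)%R = \int[leb]_x f x.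
Proof.
move=> mf f0; pose phi := fun x : measurableTypeR R => (x + a)%R : measurableTypeR R.
have mphi : measurable_fun setT phi by apply: measurable_funD.
have -> : \int[leb]_x f (x + a)%R = \int[leb]_(x in phi @^-1` setT) (f \o phi) x.
  by rewrite preimage_setT.
rewrite -(ge0_integral_pushforward mphi leb measurableT mf); last by move=> y _; exact: f0.
apply: eq_measure_integral => A mA _.
apply/esym; apply: lebesgue_measure_unique => // _ [[x y] _ <-] /=.
rewrite /pushforward /=.
have -> : phi @^-1` `]x, y] = `](x - a)%R, (y - a)%R]%classic.
  by apply/seteqP; split => z; rewrite /phi /= !in_itv /= ltrBlDr lerBrDr.
rewrite !lebesgue_measure_itv /= !lte_fin ltrD2r; case: ifP => // _.
by rewrite -!EFinB; congr (_%:E); lra.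
Qed.

Lemma lebesgue_reflect (a : R) f : measurable_fun setT f -> (forall x, 0 <= f x) ->
  \int[leb]_x f (a - x)%R = \int[leb]_x f x.
Proof.
move=> mf f0; pose phi := fun x : measurableTypeR R => (a - x)%R : measurableTypeR R.
have mphi : measurable_fun setT phi by apply: measurable_funB.
have -> : \int[leb]_x f (a - x)%R = \int[leb]_(x in phi @^-1` setT) (f \o phi) x.
  by rewrite preimage_setT.
rewrite -(ge0_integral_pushforward mphi leb measurableT mf); last by move=> y _; exact: f0.
apply: eq_measure_integral => A mA _.
apply/esym; apply: lebesgue_measure_unique => // _ [[x y] _ <-] /=.
rewrite /pushforward /=.
have -> : phi @^-1` `]x, y] = `[(a - y)%R, (a - x)%R[%classic.
  apply/seteqP; split => z; rewrite /phi /= !in_itv /=;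
  by move=> /andP[h1 h2]; apply/andP; split; lra.
rewrite !lebesgue_measure_itv /= !lte_fin ltrD2l ltrN2; case: ifP => // _.
by rewrite -!EFinB; congr (_%:E); lra.
Qed.

Lemma int_itv0y f :
  \int[leb]_(x in `[0%R, +oo[) f x = \int[leb]_x (if (0 <= x)%R then f x else 0).
Proof.
rewrite integral_mkcond; apply: eq_integral => x _; rewrite patchE.
by rewrite mem_setE in_itv /= andbT.
Qed.

Lemma int_itv0t (t : R) f : \int[leb]_(x in `[0%R, t]) f x =
  \int[leb]_x (if (0 <= x <= t)%R then f x else 0).
Proof.
rewrite integral_mkcond; apply: eq_integral => x _; rewrite patchE.
by rewrite mem_setE in_itv.
Qed.

Lemma measurable_if0 d (T : measurableType d) (b : T -> bool) (f : T -> \bar R) :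
  measurable_fun setT b -> measurable_fun setT f ->
  measurable_fun setT (fun x => if b x then f x else 0).
Proof. by move=> mb mf; apply: measurable_fun_ifT. Qed.

Lemma if0_ge0 (b : bool) (x : \bar R) : 0 <= x -> 0 <= if b then x else 0.
Proof. by case: b. Qed.

Lemma measurable_ge0 d (T : measurableType d) (f : T -> R) :
  measurable_fun setT f -> measurable_fun setT (fun x => 0 <= f x)%R.
Proof. by move=> mf; apply: measurable_fun_ler. Qed.

Lemma measurable_itvb d (T : measurableType d) (f g : T -> R) :
  measurable_fun setT f -> measurable_fun setT g ->
  measurable_fun setT (fun x => 0 <= f x <= g x)%R.
Proof. by move=> mf mg; apply: measurable_and; apply: measurable_fun_ler. Qed.

Lemma measurable_int0y d (T : measurableType d) (f : T * R -> \bar R) :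
  measurable_fun setT f -> (forall x, 0 <= f x) ->
  measurable_fun setT (fun t => \int[leb]_(r in `[0%R, +oo[) f (t, r)).
Proof.
move=> mf f0; under eq_fun do rewrite int_itv0y.
apply: (measurable_lint (f := fun p => if (0 <= p.2)%R then f p else 0)).
  by apply: measurable_if0 => //; apply: measurable_ge0.
by move=> p; exact: if0_ge0.
Qed.

Lemma measurable_int0t d (T : measurableType d) (f : T * R -> \bar R) (g : T -> R) :
  measurable_fun setT f -> measurable_fun setT g -> (forall x, 0 <= f x) ->
  measurable_fun setT (fun t => \int[leb]_(r in `[0%R, g t]) f (t, r)).
Proof.
move=> mf mg f0; under eq_fun do rewrite int_itv0t.
apply: (measurable_lint (f := fun p => if (0 <= p.2 <= g p.1)%R then f p else 0)).
  by apply: measurable_if0 => //; apply: measurable_itvb => //; exact: measurableT_comp.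
by move=> p; exact: if0_ge0.
Qed.

Lemma fubini0y (f : R * R -> \bar R) :
  measurable_fun setT f -> (forall x, 0 <= f x) ->
  \int[leb]_(x in `[0%R, +oo[) \int[leb]_(y in `[0%R, +oo[) f (x, y) =
  \int[leb]_(y in `[0%R, +oo[) \int[leb]_(x in `[0%R, +oo[) f (x, y).
Proof.
move=> mf f0; rewrite !int_itv0y.
pose F (p : R * R) := if (0 <= p.1)%R then if (0 <= p.2)%R then f p else 0 else 0.
transitivity (\int[leb]_x \int[leb]_y F (x, y)).
  apply: eq_integral => x _; rewrite int_itv0y /F /=.
  by case: ifP => // _; rewrite integral0.
rewrite fubini_line.
- apply: eq_integral => y _; rewrite int_itv0y /F /=.
  by case: ifP => y0; [|rewrite integral0_eq // => x _; case: ifP].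
- apply: measurable_if0; first exact: measurable_ge0.
  by apply: measurable_if0 => //; exact: measurable_ge0.
- by move=> p; do 2 apply: if0_ge0.
Qed.

Lemma continuous_expRM (c : R) : continuous (fun x : R => expR (c * x)).
Proof.
move=> x; apply: continuous_comp; last exact: continuous_expR.
exact: mulrl_continuous.
Qed.

Lemma int_expRM (c z : R) : (0 <= z)%R ->
  \int[leb]_(x in `[0%R, z]) (c * expR (c * x))%:E = (expR (c * z) - 1)%:E.
Proof.
rewrite le_eqVlt => /predU1P[<-|z0].
  by rewrite set_itv1 integral_set1 mulr0 expR0 subrr.
rewrite (@continuous_FTC2 _ _ (fun x => expR (c * x)) 0 z z0); first by rewrite mulr0 expR0.
- apply: continuous_subspaceT => x.
  apply: (@continuous_comp R R R (fun x => expR (c * x)) ( *%R c)).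
    exact: continuous_expRM.
  exact: mulrl_continuous.
- split.
  + by move=> x _; exact: ex_derive.
  + by apply/cvg_at_right_filter; exact: continuous_expRM.
  + by apply/cvg_at_left_filter; exact: continuous_expRM.
- move=> x _; rewrite derive1_comp // derive1E.
  have /funeqP -> := @derive_expR R.
  by rewrite derive1Ml // derive1_id mulr1 mulrC.
Qed.

Lemma ge0_int_cst_mul (D : set R) (c : \bar R) (f : R -> \bar R) : measurable D ->
  measurable_fun setT f -> (forall x, 0 <= f x) -> 0 <= c ->
  \int[leb]_(x in D) (c * f x) = c * \int[leb]_(x in D) f x.
Proof. by move=> mD mf f0 c0; rewrite ge0_integralZl //; exact: measurable_funTS. Qed.

Lemma measurable_expRM d (T : measurableType d) (c : R) (f : T -> R) :
  measurable_fun setT f -> measurable_fun setT (fun x => (expR (c * f x))%:E).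
Proof.
move=> mf; apply/measurable_EFinP; apply: measurableT_comp => //.
by apply: measurable_funM.
Qed.

(* The law of the sum of independent exponentials of rates [a] and [b]. *)
Lemma int_exp_convolution (a b : R) (G : R -> \bar R) : (a <= b)%R ->
  measurable_fun setT G -> (forall x, 0 <= G x) ->
  (b - a)%:E * \int[leb]_(x in `[0%R, +oo[) \int[leb]_(y in `[0%R, +oo[)
      ((expR (- a * x))%:E * ((expR (- b * y))%:E * G (x + y)%R)) +
  \int[leb]_(z in `[0%R, +oo[) ((expR (- b * z))%:E * G z) =
  \int[leb]_(z in `[0%R, +oo[) ((expR (- a * z))%:E * G z).
Proof.
move=> ab mG G0.
have e0 (x : R) : 0 <= (expR x)%:E by rewrite lee_fin expR_ge0.
pose F (p : R * R) : \bar R := if (0 <= p.1 <= p.2)%R then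
  (expR ((b - a) * p.1))%:E * ((expR (- b * p.2))%:E * G p.2) else 0.
have F0 p : 0 <= F p by apply: if0_ge0; rewrite !mule_ge0.
have mF : measurable_fun setT F.
  apply: measurable_if0; first exact: measurable_itvb.
  apply: emeasurable_funM; first exact: measurable_expRM.
  apply: emeasurable_funM; first exact: measurable_expRM.
  exact: measurableT_comp.
have mFs : measurable_fun setT (fun p : R * R => F (p.2, p.1)).
  by apply: (measurableT_comp mF); exact: measurable_fun_pair.
have mbG : measurable_fun setT (fun z => (expR (- b * z))%:E * G z).
  by apply: emeasurable_funM => //; exact: measurable_expRM.
have -> : \int[leb]_(x in `[0%R, +oo[) \int[leb]_(y in `[0%R, +oo[)
      ((expR (- a * x))%:E * ((expR (- b * y))%:E * G (x + y)%R)) =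
   \int[leb]_x \int[leb]_z F (x, z).
  rewrite int_itv0y; apply: eq_integral => x _; rewrite /F /=.
  case: (leP 0%R x) => x0 /=; last by rewrite integral0.
  rewrite int_itv0y -(lebesgue_shift (- x)).
  - apply: eq_integral => z _; rewrite subr_ge0; case: ifP => // _.
    rewrite [(x + _)%R]addrC subrK !muleA -!EFinM -!expRD; congr ((expR _)%:E * _).
    by ring.
  - apply: measurable_if0; first exact: measurable_ge0.
    apply: emeasurable_funM; first exact: measurable_cst.
    apply: emeasurable_funM; first exact: measurable_expRM.
    by apply: measurableT_comp => //; apply: measurable_funD.
  - by move=> y; apply: if0_ge0; rewrite !mule_ge0.
rewrite fubini_line // !int_itv0y -ge0_integralZl_EFin ?subr_ge0 //; last 2 first.
  by move=> x _; apply: integral_ge0.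
  exact: (measurable_lint (f := fun p => F (p.2, p.1))).
rewrite -ge0_integralD //.
- apply: eq_integral => z _; rewrite {1}/F /=.
  case: (leP 0%R z) => z0; last first.
    rewrite integral0_eq ?mule0 ?adde0 // => x _; case: ifP => // /andP[h1 h2].
    by have := lt_le_trans z0 (le_trans h1 h2); rewrite ltxx.
  rewrite -(int_itv0t z (fun x => (expR ((b - a) * x))%:E * ((expR (- b * z))%:E * G z))).
  under eq_integral do rewrite muleC.
  rewrite ge0_int_cst_mul ?mule_ge0 //; last exact: measurable_expRM.
  rewrite muleCA -ge0_integralZl_EFin ?subr_ge0 //; last first.
    by apply: measurable_funTS; exact: measurable_expRM.
  under eq_integral do rewrite -EFinM.
  rewrite int_expRM // muleC -{2}[_ * G z]mul1e -ge0_muleDl //; last first.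
    rewrite lee_fin subr_ge0 -expR0 ler_expR mulr_ge0 ?subr_ge0 //.
  rewrite -EFinD subrK muleA -EFinM -expRD; congr ((expR _)%:E * _); ring.
- by move=> z _; rewrite mule_ge0 ?lee_fin ?subr_ge0 //; apply: integral_ge0.
- apply: measurable_funeM; exact: (measurable_lint (f := fun p => F (p.2, p.1))).
- by move=> z _; apply: if0_ge0; rewrite mule_ge0.
- by apply: measurable_if0 => //; exact: measurable_ge0.
Qed.

End LineIntegrals.

Section IteratedIntegral.
Context {R : realType}.
Notation leb := (@lebesgue_measure R).
Local Open Scope ereal_scope.

Lemma iint_ge0 k (g : k.-tuple R -> \bar R) : (forall s, 0 <= g s) -> 0 <= iint g.
Proof.
by elim: k g => [|k IH] g g0 /=; [exact: g0|apply: integral_ge0 => y _; exact: IH].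
Qed.

Lemma measurable_iint k d (T : measurableType d) (g : T * k.-tuple R -> \bar R) :
  measurable_fun setT g -> (forall p, 0 <= g p) ->
  measurable_fun setT (fun t => iint (fun s => g (t, s))).
Proof.
elim: k d T g => [|k IH] d T g mg g0 /=.
  by apply: (measurableT_comp mg); exact: measurable_fun_pair.
apply: (measurable_int0y (f := fun p : T * R => iint (fun s => g (p.1, [tuple of p.2 :: s])))).
  apply: (IH _ _ (fun q : T * R * k.-tuple R => g (q.1.1, [tuple of q.1.2 :: q.2]))) => //.
  apply: (measurableT_comp mg); apply: measurable_fun_pair; first exact: measurableT_comp.
  by apply: measurable_cons => //; exact: measurableT_comp.
by move=> p; exact: iint_ge0.
Qed.

Lemma measurable_tcons k : measurable_fun setT
  (fun p : R * k.-tuple R => [tuple of p.1 :: p.2]).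
Proof. exact: measurable_cons. Qed.

Lemma measurable_fun_tcons k (g : k.+1.-tuple R -> \bar R) (y : R) :
  measurable_fun setT g -> measurable_fun setT (fun s : k.-tuple R => g [tuple of y :: s]).
Proof. by move=> mg; apply: (measurableT_comp mg); exact: measurable_cons. Qed.

Lemma measurable_iint_tcons k (g : k.+1.-tuple R -> \bar R) :
  measurable_fun setT g -> (forall s, 0 <= g s) ->
  measurable_fun setT (fun y => iint (fun s : k.-tuple R => g [tuple of y :: s])).
Proof.
move=> mg g0; apply: (measurable_iint (g := fun p : R * k.-tuple R => g [tuple of p.1 :: p.2])) => //.
by apply: (measurableT_comp mg); exact: measurable_tcons.
Qed.

Lemma eq_iint k (g h : k.-tuple R -> \bar R) : g =1 h -> iint g = iint h.
Proof. by move=> /funext ->. Qed.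

Lemma iintD k (g h : k.-tuple R -> \bar R) :
  measurable_fun setT g -> measurable_fun setT h ->
  (forall s, 0 <= g s) -> (forall s, 0 <= h s) ->
  iint (fun s => g s + h s) = iint g + iint h.
Proof.
elim: k g h => [|k IH] g h mg mh g0 h0 //=.
rewrite -ge0_integralD //; last 4 first.
- by move=> *; exact: iint_ge0.
- by apply: measurable_funTS; exact: measurable_iint_tcons.
- by move=> *; exact: iint_ge0.
- by apply: measurable_funTS; exact: measurable_iint_tcons.
by apply: eq_integral => y _; rewrite IH //; exact: measurable_fun_tcons.
Qed.

Lemma iintZ k (g : k.-tuple R -> \bar R) (c : \bar R) : 0 <= c ->
  measurable_fun setT g -> (forall s, 0 <= g s) ->
  iint (fun s => c * g s) = c * iint g.
Proof.
elim: k g => [|k IH] g c0 mg g0 //=.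
rewrite -ge0_integralZl //; last 2 first.
- by apply: measurable_funTS; exact: measurable_iint_tcons.
- by move=> *; exact: iint_ge0.
by apply: eq_integral => y _; rewrite IH //; exact: measurable_fun_tcons.
Qed.

Lemma le_iint k (g h : k.-tuple R -> \bar R) :
  measurable_fun setT g -> measurable_fun setT h ->
  (forall s, 0 <= g s) -> (forall s, g s <= h s) -> iint g <= iint h.
Proof.
elim: k g h => [|k IH] g h mg mh g0 gh //=.
have h0 s : 0 <= h s by exact: le_trans (gh s).
apply: ge0_le_integral => //.
- by move=> *; exact: iint_ge0.
- by apply: measurable_funTS; exact: measurable_iint_tcons.
- by apply: measurable_funTS; exact: measurable_iint_tcons.
- by move=> y _; apply: IH => //; exact: measurable_fun_tcons.
Qed.

Lemma iint_monotone_convergence k (g : (k.-tuple R -> \bar R)^nat) :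
  (forall i, measurable_fun setT (g i)) -> (forall i s, 0 <= g i s) ->
  (forall s, {homo g ^~ s : i j / (i <= j)%N >-> i <= j}) ->
  iint (fun s => limn (g ^~ s)) = limn (fun i => iint (g i)).
Proof.
elim: k g => [|k IH] g mg g0 ndg //=.
rewrite -monotone_convergence //.
- apply: eq_integral => y _.
  by rewrite (IH (fun i s => g i [tuple of y :: s])) // => i; exact: measurable_fun_tcons.
- by move=> i; apply: measurable_funTS; exact: measurable_iint_tcons.
- by move=> *; exact: iint_ge0.
- by move=> y _ i j ij; apply: le_iint => [||//|s]; [exact: measurable_fun_tcons..|exact: ndg].
Qed.

Lemma measurable_fun_trcons k d (T : measurableType d) (f : T -> k.-tuple R) (g : T -> R) :
  measurable_fun setT f -> measurable_fun setT g ->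
  measurable_fun setT (fun x => [tuple of rcons (f x) (g x)]).
Proof.
move=> mf mg; apply/measurable_fun_tnthP => i; case: (ltnP i k) => ik.
  rewrite (_ : _ \o _ = (fun s => tnth s (Ordinal ik)) \o f); last first.
    by apply/funext => x; rewrite /= !(tnth_nth 0%R) /= nth_rcons size_tuple ik.
  by move/measurable_fun_tnthP : mf; exact.
rewrite (_ : _ \o _ = g) //; apply/funext => x.
rewrite /= !(tnth_nth 0%R) /= nth_rcons size_tuple ltnNge ik /=.
by rewrite (_ : (i : nat) = k) ?eqxx //; have := ltn_ord i; lia.
Qed.

Lemma iint_rcons k (g : k.+1.-tuple R -> \bar R) :
  measurable_fun setT g -> (forall s, 0 <= g s) ->
  iint g = \int[leb]_(b in `[0%R, +oo[) iint (fun s : k.-tuple R => g [tuple of rcons s b]).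
Proof.
elim: k g => [|k IH] g mg g0.
  by apply: eq_integral => y _ /=; congr g; exact: val_inj.
transitivity (\int[leb]_(y in `[0%R, +oo[) \int[leb]_(b in `[0%R, +oo[)
   iint (fun s : k.-tuple R => g [tuple of y :: [tuple of rcons s b]])).
  apply: eq_integral => y _; rewrite -(IH (fun t => g [tuple of y :: t])) //.
  exact: measurable_fun_tcons.
rewrite (fubini0y (f := fun p : R * R => iint (fun s : k.-tuple R => g [tuple of p.1 :: [tuple of rcons s p.2]]))).
- apply: eq_integral => b _ /=; apply: eq_integral => y _.
  by apply: eq_iint => s; congr g; exact: val_inj.
- apply: (measurable_iint (g := fun q : R * R * k.-tuple R =>
    g [tuple of q.1.1 :: [tuple of rcons q.2 q.1.2]])) => //.
  apply: (measurableT_comp mg); apply: measurable_cons; first exact: measurableT_comp.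
  by apply: measurable_fun_trcons => //; exact: measurableT_comp.
- by move=> p; exact: iint_ge0.
Qed.


Definition edens (al : nat -> R) k (s : k.-tuple R) : \bar R :=
  (expR (- \sum_(j < k) al j * tnth s j))%:E.

Lemma edens_ge0 al k (s : k.-tuple R) : 0 <= edens al s.
Proof. by rewrite lee_fin expR_ge0. Qed.

Lemma measurable_edens al k : measurable_fun setT (@edens al k).
Proof.
apply/measurable_EFinP; apply: measurableT_comp => //.
apply: measurableT_comp => //; apply: measurable_sum => j.
by apply: measurable_funM => //; exact: measurable_tnth.
Qed.

Lemma edens_cons (al : nat -> R) k (y : R) (s : k.-tuple R) :
  edens al [tuple of y :: s] = (expR (- al 0%N * y))%:E * edens (al \o S) s.
Proof.
rewrite /edens -EFinM -expRD big_ord_recl; congr ((expR _)%:E).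
rewrite tnth0 opprD mulNr; congr (_ - _)%R.
by apply: eq_bigr => j _; rewrite tnthS.
Qed.

Lemma edens_rcons al k (s : k.-tuple R) (b : R) :
  edens al [tuple of rcons s b] = edens al s * (expR (- al k * b))%:E.
Proof.
rewrite /edens -EFinM -expRD big_ord_recr; congr ((expR _)%:E).
rewrite opprD mulNr; congr (- _ - _)%R.
  apply: eq_bigr => j _; rewrite !(tnth_nth 0%R) /= nth_rcons size_tuple.
  by rewrite ltn_ord.
by rewrite (tnth_nth 0%R) /= nth_rcons size_tuple ltnn eqxx.
Qed.

Lemma eq_edens al al' k (s : k.-tuple R) :
  (forall j, (j < k)%N -> al j = al' j) -> edens al s = edens al' s.
Proof.
move=> h; rewrite /edens; congr ((expR (- _))%:E).
by apply: eq_bigr => j _; rewrite h.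
Qed.

Definition skip (p : nat) (al : nat -> R) (j : nat) := al (if (j < p)%N then j else j.+1).

(* Intervals after the removal of node [q.+1] (nodes are counted from 1). *)
Definition rho k (q : nat) (s : k.+1.-tuple R) : k.-tuple R :=
  [tuple (if (i.+1 < q)%N then nth 0 s i
          else if i.+1 == q then nth 0 s i + nth 0 s i.+1
          else nth 0 s i.+1)%R | i < k].

Lemma rho0 k (y : R) (s : k.-tuple R) : rho 0%N [tuple of y :: s] = s.
Proof. by apply: eq_from_tnth => i; rewrite tnth_mktuple /= (tnth_nth 0%R). Qed.

Lemma rho1 k (x y : R) (s : k.-tuple R) :
  rho 1%N [tuple of x :: [tuple of y :: s]] = [tuple of (x + y)%R :: s].
Proof.
by apply: eq_from_tnth => i; rewrite tnth_mktuple /= (tnth_nth 0%R); case: i => -[|i].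
Qed.

Lemma rhoS k q (y : R) (s : k.+1.-tuple R) :
  rho q.+2 [tuple of y :: s] = [tuple of y :: rho q.+1 s].
Proof.
apply: eq_from_tnth => -[[|i] h]; first by rewrite tnth_mktuple /= (tnth_nth 0%R).
have hk : (i < k)%N by [].
rewrite (_ : Ordinal h = lift ord0 (Ordinal hk)); last exact: val_inj.
by rewrite tnthS !tnth_mktuple.
Qed.

Lemma measurable_nth k (i : nat) : measurable_fun setT (fun s : k.-tuple R => nth 0%R s i).
Proof.
case: (ltnP i k) => ik.
  apply: (@eq_measurable_fun _ _ _ _ _ (fun s => tnth s (Ordinal ik))).
    by move=> s _; rewrite (tnth_nth 0%R).
  exact: measurable_tnth.
rewrite (_ : (fun s => _) = cst 0%R) //; apply/funext => s.
by rewrite nth_default // size_tuple.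
Qed.

Lemma measurable_rho k q : measurable_fun setT (@rho k q).
Proof.
apply/measurable_fun_tnthP => i.
apply: (@eq_measurable_fun _ _ _ _ _ (fun s : k.+1.-tuple R => (if (i.+1 < q)%N then nth 0 s i
          else if i.+1 == q then nth 0 s i + nth 0 s i.+1
          else nth 0 s i.+1)%R)).
  by move=> s _; rewrite /= tnth_mktuple.
case: (i.+1 < q)%N; first exact: measurable_nth.
by case: (i.+1 == q); [apply: measurable_funD|]; exact: measurable_nth.
Qed.

Lemma measurable_edensM al k (G : k.-tuple R -> \bar R) : measurable_fun setT G ->
  measurable_fun setT (fun s => edens al s * G s).
Proof. by move=> mG; apply: emeasurable_funM => //; exact: measurable_edens. Qed.

Lemma iint_cons_edens al k (G : k.+1.-tuple R -> \bar R) : measurable_fun setT G ->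
  (forall s, 0 <= G s) ->
  iint (fun s => edens al s * G s) = \int[leb]_(y in `[0%R, +oo[)
    ((expR (- al 0%N * y))%:E * iint (fun s : k.-tuple R => edens (al \o S) s * G [tuple of y :: s])).
Proof.
move=> mG G0; apply: eq_integral => y _; rewrite -iintZ //.
- by apply: eq_iint => s; rewrite edens_cons muleA.
- by apply: measurable_edensM; exact: measurable_fun_tcons.
- by move=> s; rewrite mule_ge0 // edens_ge0.
Qed.

Lemma measurable_iint_edens al k (G : k.+1.-tuple R -> \bar R) : measurable_fun setT G ->
  (forall s, 0 <= G s) ->
  measurable_fun setT (fun y => iint (fun s : k.-tuple R => edens al s * G [tuple of y :: s])).
Proof.
move=> mG G0; apply: (measurable_iint (g := fun p : R * k.-tuple R => edens al p.2 * G [tuple of p.1 :: p.2])).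
  apply: emeasurable_funM; first by apply: measurableT_comp => //; exact: measurable_edens.
  by apply: (measurableT_comp mG); exact: measurable_tcons.
by move=> p; rewrite mule_ge0 // edens_ge0.
Qed.

Lemma iint_edens_ge0 al k (G : k.-tuple R -> \bar R) : (forall s, 0 <= G s) ->
  0 <= iint (fun s => edens al s * G s).
Proof. by move=> G0; apply: iint_ge0 => s; rewrite mule_ge0 // edens_ge0. Qed.

Lemma iint_rho_merge p (al : nat -> R) k (G : k.-tuple R -> \bar R) : (p < k)%N ->
  (forall j, al j <= al j.+1)%R -> measurable_fun setT G -> (forall s, 0 <= G s) ->
  (al p.+1 - al p)%:E * iint (fun s : k.+1.-tuple R => edens al s * G (rho p.+1 s)) +
    iint (fun s => edens (skip p al) s * G s) =
  iint (fun s => edens (skip p.+1 al) s * G s).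
Proof.
have e0 (x : R) : 0 <= (expR x)%:E by rewrite lee_fin expR_ge0.
elim: p al k G => [|p IH] al [//|k] G pk alS mG G0.
  rewrite !iint_cons_edens //; last by apply: (measurableT_comp mG); exact: measurable_rho.
  pose Gam z := iint (fun s : k.-tuple R => edens (al \o S \o S) s * G [tuple of z :: s]).
  have mGam : measurable_fun setT Gam by exact: measurable_iint_edens.
  have Gam0 z : 0 <= Gam z by exact: iint_edens_ge0.
  rewrite -[RHS](int_exp_convolution (a := al 0%N) (b := al 1%N) (G := Gam)) //.
  congr (_ * _ + _).
  apply: eq_integral => x _; rewrite iint_cons_edens //; last first.
    apply: (measurable_fun_tcons (g := fun s => G (rho 1%N s))).
    by apply: (measurableT_comp mG); exact: measurable_rho.
  rewrite -ge0_int_cst_mul //.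
  - apply: eq_integral => y _; congr (_ * (_ * _)); apply: eq_iint => s.
    by rewrite rho1.
  - apply: emeasurable_funM; first exact: measurable_expRM.
    apply: (@measurable_iint_edens _ _ (fun s => G (rho 1%N [tuple of x :: s]))) => //.
    apply: (measurable_fun_tcons (g := fun s => G (rho 1%N s))).
    by apply: (measurableT_comp mG); exact: measurable_rho.
  - by move=> y; rewrite mule_ge0 //; apply: iint_edens_ge0.
have mGr : measurable_fun setT (fun s => G (rho p.+2 s)).
  by apply: (measurableT_comp mG); exact: measurable_rho.
have ai : (0 <= al p.+2 - al p.+1)%R by rewrite subr_ge0.
rewrite !iint_cons_edens //.
rewrite -ge0_integralZl_EFin //; last 2 first.
- by move=> y _; rewrite mule_ge0 //; apply: iint_edens_ge0.
- apply: measurable_funTS; apply: emeasurable_funM; first exact: measurable_expRM.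
  exact: (@measurable_iint_edens _ _ (fun s => G (rho p.+2 s))).
rewrite -ge0_integralD //; last 4 first.
- by move=> y _; rewrite !mule_ge0 ?lee_fin //; apply: iint_edens_ge0.
- apply: measurable_funTS; apply: measurable_funeM; apply: emeasurable_funM; first exact: measurable_expRM.
  exact: (@measurable_iint_edens _ _ (fun s => G (rho p.+2 s))).
- by move=> y _; rewrite !mule_ge0 //; apply: iint_edens_ge0.
- apply: measurable_funTS; apply: emeasurable_funM; first exact: measurable_expRM.
  exact: measurable_iint_edens.
apply: eq_integral => y _.
have E q : edens (skip q.+1 al \o S) (k := k) =1 edens (skip q (al \o S)) (k := k).
  by move=> s; apply: eq_edens => j _; rewrite /skip /= ltnS; case: ifP.
rewrite muleCA -ge0_muleDr; last 2 first.
- by rewrite mule_ge0 ?lee_fin //; apply: iint_edens_ge0.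
- by apply: iint_edens_ge0.
congr (_ * _).
under [X in _ = X]eq_iint do rewrite E.
have alS' j : ((al \o S) j <= (al \o S) j.+1)%R by exact: alS.
rewrite -(IH (al \o S) k (fun s => G [tuple of y :: s])) //; last exact: measurable_fun_tcons.
congr (_ * _ + _).
  by apply: eq_iint => s; rewrite rhoS.
by apply: eq_iint => s; rewrite E.
Qed.

Lemma iint_rho_drop (al : nat -> R) k (G : k.-tuple R -> \bar R) : (0 < al 0%N)%R ->
  measurable_fun setT G -> (forall s, 0 <= G s) ->
  (al 0%N)%:E * iint (fun s : k.+1.-tuple R => edens al s * G (rho 0%N s)) =
  iint (fun s => edens (skip 0%N al) s * G s).
Proof.
move=> a0 mG G0; rewrite iint_cons_edens //; last by apply: (measurableT_comp mG); exact: measurable_rho.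
have -> : \int[leb]_(y in `[0%R, +oo[) ((expR (- al 0%N * y))%:E *
    iint (fun s : k.-tuple R => edens (al \o S) s * G (rho 0%N [tuple of y :: s]))) =
  \int[leb]_(y in `[0%R, +oo[) (iint (fun s => edens (skip 0%N al) s * G s) * (expR (- al 0%N * y))%:E).
  apply: eq_integral => y _; rewrite muleC; congr (_ * _).
  by apply: eq_iint => s; rewrite rho0.
rewrite ge0_int_cst_mul //; last 2 first.
- exact: measurable_expRM.
- exact: iint_edens_ge0.
rewrite muleCA -ge0_integralZl_EFin //; last 2 first.
- by apply: measurable_funTS; exact: measurable_expRM.
- exact: ltW.
rewrite -[RHS]mule1; congr (_ * _).
rewrite -(integral_exponential_pdf a0) int_itv0y.
apply: eq_integral => y _; rewrite /exponential_pdf patchE mem_setE in_itv /= andbT.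
by case: ifP.
Qed.

(* Removing the node of rank [q.+1] with probability proportional to the
   increment of the rates preserves the product of exponential laws. *)
Lemma iint_rho_sum (al : nat -> R) k (G : k.-tuple R -> \bar R) : (0 < al 0%N)%R ->
  (forall j, al j <= al j.+1)%R -> measurable_fun setT G -> (forall s, 0 <= G s) ->
  \sum_(q < k.+1) (al q - (if (q : nat) is j.+1 then al j else 0))%:E *
     iint (fun s : k.+1.-tuple R => edens al s * G (rho q s)) =
  iint (fun s => edens al s * G s).
Proof.
move=> a0 alS mG G0.
have H p : (p <= k)%N -> \sum_(q < p.+1) (al q - (if (q : nat) is j.+1 then al j else 0))%:E *
     iint (fun s : k.+1.-tuple R => edens al s * G (rho q s)) =
  iint (fun s => edens (skip p al) s * G s).
  elim: p => [_|p IH pk]; first by rewrite big_ord1 subr0 iint_rho_drop.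
  by rewrite big_ord_recr /= IH 1?ltnW // addeC iint_rho_merge.
rewrite H //; apply: eq_iint => s; congr (_ * _).
by apply: eq_edens => j jk; rewrite /skip jk.
Qed.

Lemma iint_edens1 (al : nat -> R) k : (forall j, 0 < al j)%R ->
  iint (fun s : k.-tuple R => edens al s) = (\prod_(j < k) (al j)^-1)%:E.
Proof.
elim: k al => [|k IH] al al0.
  by rewrite /= /edens !big_ord0 oppr0 expR0.
have -> : iint (fun s : k.+1.-tuple R => edens al s) = iint (fun s : k.+1.-tuple R => edens al s * 1).
  by apply: eq_iint => s; rewrite mule1.
rewrite iint_cons_edens //.
have -> : iint (fun s : k.-tuple R => edens (al \o S) s * 1) = (\prod_(j < k) (al j.+1)^-1)%:E.
  transitivity (iint (fun s : k.-tuple R => edens (al \o S) s)); last first.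
    by apply: IH => j; exact: al0.
  by apply: eq_iint => s; rewrite mule1.
have p0 : (0 <= \prod_(j < k) (al j.+1)^-1)%R.
  by apply: prodr_ge0 => j _; rewrite invr_ge0 ltW.
have e0 (x : R) : 0 <= (expR x)%:E by rewrite lee_fin expR_ge0.
under eq_integral do rewrite muleC.
rewrite ge0_int_cst_mul ?lee_fin //; last exact: measurable_expRM.
rewrite big_ord_recl mulrC EFinM; congr (_ * _).
have : (al 0%N)%:E * \int[leb]_(x in `[0%R, +oo[) (expR (- al 0%N * x))%:E = 1.
  rewrite -ge0_integralZl_EFin //; last 2 first.
  - by apply: measurable_funTS; exact: measurable_expRM.
  - exact: ltW.
  rewrite -(integral_exponential_pdf (al0 0%N)) int_itv0y.
  apply: eq_integral => y _; rewrite /exponential_pdf patchE mem_setE in_itv /= andbT.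
  by case: ifP.
move=> /(congr1 (fun x => (al 0%N)^-1%:E * x)); rewrite muleA -EFinM mulVf ?gt_eqF //.
by rewrite mul1e mule1.
Qed.

End IteratedIntegral.

Section MoranKernel.
Context {R : realType} {n : nat}.
Notation leb := (@lebesgue_measure R).
Notation mstate := (mstate R n).
Local Open Scope ereal_scope.
Implicit Types (x y : mstate) (E : set mstate) (t r : R).

Lemma measurable_fun_flow d (T : measurableType d) (f : T -> R) (g : T -> mstate) :
  measurable_fun setT f -> measurable_fun setT g ->
  measurable_fun setT (fun z => flow (f z) (g z)).
Proof.
move=> mf mg; have m1 : measurable_fun setT (fun z => (g z).1) by exact: measurableT_comp.
have m2 : measurable_fun setT (fun z => (g z).2) by exact: measurableT_comp.
apply: measurable_fun_pair => //; apply/measurable_fun_tnthP => i.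
rewrite (_ : _ \o _ = fun z => if i.+1 == n.-1 then (tnth (g z).2 i + f z)%R else tnth (g z).2 i).
  have mi : measurable_fun setT (fun z => tnth (g z).2 i).
    by move/measurable_fun_tnthP : m2; exact.
  by case: (i.+1 == n.-1) => //; exact: measurable_funD.
by apply/funext => z; rewrite /= tnth_mktuple.
Qed.

Lemma measurable_fun_mstate d (T : measurableType d) (f : mstate -> T) :
  (forall w, measurable_fun setT (fun s : n.-1.-tuple R => f (w, s))) ->
  measurable_fun setT f.
Proof.
move=> mf _ Y mY; rewrite setTI.
have -> : f @^-1` Y = \big[setU/set0]_(w : rtree n) ([set w] `*` ((fun s => f (w, s)) @^-1` Y)).
  apply/seteqP; split=> [[w s] /= fY|[w s]].
    by rewrite -bigcup_seq; exists w => //=; exact: mem_index_enum.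
  by rewrite -bigcup_seq => -[w' _ [/= -> ]].
apply: bigsetU_measurable => w _; apply: measurableX => //.
by rewrite -[X in measurable X]setTI; exact: mf.
Qed.

Lemma measurable_move_s (m : nat) : measurable_fun setT (fun s : n.-1.-tuple R => move_s s m).
Proof.
apply/measurable_fun_tnthP => i.
rewrite (_ : _ \o _ = fun s : n.-1.-tuple R =>
  if (i.+1 < m.-1)%N then nth 0%R s i
  else if i.+1 == m.-1 then (nth 0 s m.-2 + nth 0 s m.-1)%R
  else if (i.+1 < n.-1)%N then nth 0%R s i.+1 else 0%R); last first.
  by apply/funext => s; rewrite /= tnth_mktuple.
case: (i.+1 < m.-1)%N; first exact: measurable_nth.
case: (i.+1 == m.-1); first by apply: measurable_funD; exact: measurable_nth.
by case: (i.+1 < n.-1)%N => //; exact: measurable_nth.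
Qed.

Lemma measurable_jump (u v : 'I_n) : measurable_fun setT (@jump R n u v).
Proof.
apply: measurable_fun_mstate => w; apply: measurable_fun_pair => /=.
  exact: (measurable_cst (moran_tree w u v)).
exact: (measurable_move_s (prank w u)).
Qed.

Lemma measurable_fun_jump d (T : measurableType d) (u v : 'I_n) (g : T -> mstate) :
  measurable_fun setT g -> measurable_fun setT (fun z => jump u v (g z)).
Proof. by move=> mg; exact: (measurableT_comp (measurable_jump u v)). Qed.

Definition events : seq ('I_n * 'I_n) := [seq p <- index_enum _ | p.2 != p.1].

Lemma events_sum (F : 'I_n -> 'I_n -> \bar R) :
  \sum_(u : 'I_n) \sum_(v : 'I_n | v != u) F u v = \sum_(p <- events) F p.1 p.2.
Proof. by rewrite pair_big_dep /= /events big_filter. Qed.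

Lemma size_events : size events = (n * n.-1)%N.
Proof.
rewrite size_filter -sum1_count -(pair_big_dep xpredT (fun u v => v != u) (fun _ _ => 1%N)) /=.
rewrite (eq_bigr (fun=> n.-1)) ?sum_nat_const ?card_ord // => u _.
rewrite sum1_card -[RHS](card_setC1 u) [LHS]cardE [RHS]cardE.
by rewrite -[LHS]cardE -[RHS]cardE; apply: eq_card => v; rewrite !inE.
Qed.

Variable mu : R.
Hypotheses (n1 : (1 < n)%N) (mu0 : (0 < mu)%R).

Notation N := ((n * n.-1)%:R : R).

Lemma N_gt0 : (0 < N)%R.
Proof. by rewrite ltr0n; case: n n1 => [|[]]. Qed.

Definition rate r : R := (mu * expR (- (mu * r)) / N)%R.

Lemma rate_ge0 r : (0 <= rate r)%R.
Proof. by rewrite /rate !mulr_ge0 ?invr_ge0 ?expR_ge0 ?ler0n // ltW. Qed.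

Lemma measurable_rate d (T : measurableType d) (f : T -> R) : measurable_fun setT f ->
  measurable_fun setT (fun z => (rate (f z))%:E).
Proof.
move=> mf; apply/measurable_EFinP; apply: measurable_funM => //.
apply: measurable_funM => //; apply: measurableT_comp => //.
by apply: measurableT_comp => //; exact: measurable_funM.
Qed.

Lemma PkS k t x E : Pk mu k.+1 t x E = \int[leb]_(r in `[0%R, t])
  ((rate r)%:E * \sum_(p <- events) Pk mu k (t - r)%R (jump p.1 p.2 (flow r x)) E).
Proof. by apply: eq_integral => r _; rewrite events_sum. Qed.

Lemma Pk_ge0 k t x E : 0 <= Pk mu k t x E.
Proof.
elim: k t x => [|k IH] t x; first by rewrite /= mule_ge0 // lee_fin ?expR_ge0.
rewrite PkS; apply: integral_ge0 => r _; rewrite mule_ge0 ?lee_fin ?rate_ge0 //.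
by apply: sume_ge0 => p _.
Qed.

Lemma measurable_Pk k E d (T : measurableType d) (f : T -> R) (g : T -> mstate) :
  measurable E -> measurable_fun setT f -> measurable_fun setT g ->
  measurable_fun setT (fun z => Pk mu k (f z) (g z) E).
Proof.
move=> mE; elim: k d T f g => [|k IH] d T f g mf mg.
  apply: emeasurable_funM; apply/measurable_EFinP.
    apply: measurableT_comp => //; apply: measurableT_comp => //.
    exact: measurable_funM.
  apply: measurableT_comp; first exact: measurable_indic.
  exact: measurable_fun_flow.
rewrite (_ : (fun z => _) = fun z => \int[leb]_(r in `[0%R, f z]) ((rate r)%:E *
    \sum_(p <- events) Pk mu k (f z - r)%R (jump p.1 p.2 (flow r (g z))) E)); last first.
  by apply/funext => z; rewrite PkS.
apply: (measurable_int0t (f := fun q : T * R => (rate q.2)%:E *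
    \sum_(p <- events) Pk mu k (f q.1 - q.2)%R (jump p.1 p.2 (flow q.2 (g q.1))) E)) => //.
  apply: emeasurable_funM; first exact: measurable_rate.
  apply: emeasurable_sum => p; apply: IH.
    by apply: measurable_funB => //; exact: measurableT_comp.
  apply: measurable_fun_jump; apply: measurable_fun_flow => //.
  exact: measurableT_comp.
move=> q; rewrite mule_ge0 ?lee_fin ?rate_ge0 //.
by apply: sume_ge0 => p _; exact: Pk_ge0.
Qed.

Lemma measurable_Pk_integrand k t x E : measurable E -> measurable_fun setT (fun r =>
  (rate r)%:E * \sum_(p <- events) Pk mu k (t - r)%R (jump p.1 p.2 (flow r x)) E).
Proof.
move=> mE; apply: emeasurable_funM; first exact: measurable_rate.
apply: emeasurable_sum => p; apply: measurable_Pk => //; first exact: measurable_funB.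
by apply: measurable_fun_jump; exact: measurable_fun_flow.
Qed.

Lemma Pk_integrand_ge0 k t x E r :
  0 <= (rate r)%:E * \sum_(p <- events) Pk mu k (t - r)%R (jump p.1 p.2 (flow r x)) E.
Proof.
rewrite mule_ge0 ?lee_fin ?rate_ge0 //.
by apply: sume_ge0 => p _; exact: Pk_ge0.
Qed.

Lemma Pk_sigma_additive k t x (F : nat -> set mstate) :
  (forall i, measurable (F i)) -> trivIset setT F ->
  Pk mu k t x (\bigcup_i F i) = \sum_(i <oo) Pk mu k t x (F i).
Proof.
move=> mF tF; elim: k t x => [|k IH] t x.
  rewrite /= nneseriesZl; last by move=> i _; rewrite lee_fin.
  congr (_ * _).
  rewrite -[LHS]/(dirac (flow t x) (\bigcup_i F i)) measure_bigcup //=.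
  by apply: eq_eseriesl => i; rewrite in_setT.
rewrite PkS; under eq_eseriesr do rewrite PkS.
rewrite -integral_nneseries //; last 2 first.
- by move=> i; apply: measurable_funTS; exact: measurable_Pk_integrand.
- by move=> i r _; exact: Pk_integrand_ge0.
apply: eq_integral => r _; rewrite nneseriesZl; last first.
  by move=> i _; apply: sume_ge0 => p _; exact: Pk_ge0.
congr (_ * _); rewrite nneseries_sum; last by move=> p i _; exact: Pk_ge0.
by apply: eq_bigr => p _; exact: IH.
Qed.

Definition poisw k t : R := (expR (- (mu * t)) * exp_coeff (mu * t) k)%R.

Lemma poisw_ge0 k t : (0 <= t)%R -> (0 <= poisw k t)%R.
Proof. by move=> t0; rewrite mulr_ge0 ?expR_ge0 ?exp_coeff_ge0 // mulr_ge0 // ltW. Qed.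

Lemma measurable_poisw d (T : measurableType d) k (f : T -> R) : measurable_fun setT f ->
  measurable_fun setT (fun z => (poisw k (f z))%:E).
Proof.
move=> mf; apply/measurable_EFinP; apply: measurable_funM.
  apply: measurableT_comp => //; apply: measurableT_comp => //.
  exact: measurable_funM.
by apply: measurable_funM => //; apply: measurable_funX; exact: measurable_funM.
Qed.

Lemma rate_arith (m e1 e2 u v M k1 kf : R) : M != 0%R -> k1 != 0%R -> kf != 0%R ->
  (m * e1 / M * (M * (e2 * (u * v / kf))) = e1 * e2 * (m * u) / (k1 * kf) * k1 * v)%R.
Proof. by move=> h1 h2 h3; field; rewrite h1 h2 h3. Qed.

Lemma int_poisw k t : (0 <= t)%R ->
  \int[leb]_(r in `[0%R, t]) ((rate r)%:E * (N * poisw k (t - r))%:E) = (poisw k.+1 t)%:E.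
Proof.
rewrite le_eqVlt => /predU1P[<-|t0].
  by rewrite set_itv1 integral_set1 /poisw /exp_coeff /= mulr0 expr0n mul0r mulr0.
pose C : R := (expR (- (mu * t)) * mu ^+ k.+1 / k.+1`!%:R)%R.
pose f (r : R) : R := (C * k.+1%:R * (t - r) ^+ k)%R.
pose F (r : R) : R := (- C * (t - r) ^+ k.+1)%R.
have dB (r : R) : is_derive r 1%R (fun z : R => t - z)%R (-1)%R.
  apply: is_derive_eq (is_deriveB (is_derive_cst _ _ _) (is_derive_id _ _)) _.
  by rewrite sub0r.
have dF (r : R) : is_derive r 1%R F (f r).
  have dX : is_derive (t - r)%R 1%R (fun z : R => z ^+ k.+1)%R (k.+1%:R * (t - r) ^+ k)%R.
    apply: DeriveDef; first exact: exprn_derivable.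
    by rewrite exp_derive /GRing.scale /= mulr1.
  have := is_deriveZ (- C)%R
    (@is_derive1_comp R (fun z => z ^+ k.+1)%R (fun z => t - z)%R r _ _ dX (dB r)).
  move=> h; apply: (is_derive_eq (df := _) h).
  by rewrite /GRing.scale /= /f; ring.
have dc (g : R -> R) : (forall r, derivable g r 1%R) -> continuous g.
  move=> h r; apply: differentiable_continuous; exact/derivable1_diffP.
have cf : continuous f.
  move=> r; apply: (@continuous_comp R R R (fun r => (t - r) ^+ k)%R ( *%R (C * k.+1%:R)%R)).
    apply: (@continuous_comp R R R (fun r => t - r)%R (fun z => z ^+ k)%R).
      by apply: (dc (fun z => t - z)%R) => z; case: (dB z).
    exact: exprn_continuous.
  exact: mulrl_continuous.
have cF : continuous F by apply: dc => r; case: (dF r).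
transitivity (\int[leb]_(r in `[0%R, t]) (f r)%:E).
  apply: eq_integral => r _; rewrite -EFinM; congr (_%:E).
  have N0 : N != 0%R by rewrite gt_eqF // N_gt0.
  rewrite /rate /f /C /poisw /exp_coeff /= factS (natrM R k.+1).
  have k0 : k.+1%:R != 0%R :> R by rewrite pnatr_eq0.
  have kf0 : k`!%:R != 0%R :> R by rewrite pnatr_eq0 -lt0n fact_gt0.
  have -> : expR (- (mu * t)) = (expR (- (mu * r)) * expR (- (mu * (t - r))))%R.
    by rewrite -expRD; congr (expR _); ring.
  by rewrite exprMn exprS; exact: rate_arith.
rewrite (continuous_FTC2 (F := F)) //.
- rewrite /F subrr expr0n mulr0 sub0e subr0 -EFinN; congr (_%:E).
  by rewrite mulNr opprK /C /poisw /exp_coeff /= exprMn; ring.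
- exact: continuous_subspaceT.
- split; first by move=> r _; case: (dF r).
  + exact/cvg_at_right_filter/cF.
  + exact/cvg_at_left_filter/cF.
- by move=> r _; rewrite derive1E; case: (dF r).
Qed.

Lemma sum_events_cst (c : R) : \sum_(p <- events) c%:E = (N * c)%:E.
Proof.
by rewrite sumEFin big_const_seq count_predT size_events iter_addr_0 mulr_natl.
Qed.

Lemma Pk_setT k t x : (0 <= t)%R -> Pk mu k t x setT = (poisw k t)%:E.
Proof.
elim: k t x => [|k IH] t x t0.
  by rewrite /= indicT mule1 /poisw /exp_coeff /= expr0 fact0 divr1 mulr1.
rewrite PkS -int_poisw //; apply: eq_integral => r.
rewrite inE /= in_itv /= => /andP[r0 rt]; congr (_ * _).
rewrite -sum_events_cst; apply: eq_bigr => p _; apply: IH.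
by rewrite subr_ge0.
Qed.

Lemma Pk_le k t x E : measurable E -> (0 <= t)%R -> Pk mu k t x E <= (poisw k t)%:E.
Proof.
move=> mE t0; rewrite -(Pk_setT k x t0); elim: k t x t0 => [|k IH] t x t0.
  rewrite /= lee_wpmul2l ?lee_fin ?expR_ge0 // !indicE in_setT.
  by case: (_ \in _).
rewrite !PkS; apply: ge0_le_integral => //.
- by move=> r _; exact: Pk_integrand_ge0.
- by apply: measurable_funTS; exact: measurable_Pk_integrand.
- by apply: measurable_funTS; exact: measurable_Pk_integrand.
move=> r; rewrite /= in_itv /= => /andP[r0 rt].
rewrite lee_wpmul2l ?lee_fin ?rate_ge0 //.
by apply: lee_sum => p _; apply: IH; rewrite subr_ge0.
Qed.

Lemma exp_series (z : R) : (0 <= z)%R -> \sum_(k <oo) (exp_coeff z k)%:E = (expR z)%:E.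
Proof.
move=> z0; rewrite /expR -EFin_lim; last exact: is_cvg_series_exp_coeff.
by congr (limn _); apply/funext => m /=; rewrite sumEFin.
Qed.

Lemma poisw_series (th t : R) : (0 <= th)%R -> (0 <= t)%R ->
  \sum_(k <oo) (th ^+ k * poisw k t)%:E = (expR (- (mu * (1 - th) * t)))%:E.
Proof.
move=> th0 t0; have z0 : (0 <= mu * th * t)%R by rewrite !mulr_ge0 // ltW.
transitivity (\sum_(k <oo) ((expR (- (mu * t)))%:E * (exp_coeff (mu * th * t) k)%:E)).
  apply: eq_eseriesr => k _; rewrite -EFinM; congr (_%:E).
  by rewrite /poisw /exp_coeff /= mulrAC [in RHS]exprMn; ring.
rewrite nneseriesZl; last by move=> k _; rewrite lee_fin exp_coeff_ge0.
by rewrite exp_series // -EFinM -expRD; congr ((expR _)%:E); ring.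
Qed.

Lemma Ptrans_setT t x : (0 <= t)%R -> Ptrans mu t x setT = 1.
Proof.
move=> t0; rewrite -[RHS](_ : (expR (- (mu * (1 - 1) * t)))%:E = 1); last first.
  by rewrite subrr mulr0 mul0r oppr0 expR0.
rewrite -poisw_series //; apply: eq_eseriesr => k _.
by rewrite Pk_setT // expr1n mul1r.
Qed.

Lemma Ptrans_ge0 t x E : 0 <= Ptrans mu t x E.
Proof. by apply: nneseries_ge0 => k _ _; exact: Pk_ge0. Qed.

Lemma Ptrans_sigma_additive t x (F : nat -> set mstate) :
  (forall i, measurable (F i)) -> trivIset setT F ->
  Ptrans mu t x (\bigcup_i F i) = \sum_(i <oo) Ptrans mu t x (F i).
Proof.
move=> mF tF; rewrite /Ptrans nneseries_interchange; last by move=> i k; exact: Pk_ge0.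
by apply: eq_eseriesr => k _; exact: Pk_sigma_additive.
Qed.

Lemma measurable_Ptrans t E : measurable E -> measurable_fun setT (fun x => Ptrans mu t x E).
Proof.
move=> mE; apply: ge0_emeasurable_sum => [k x _ _|k _]; first exact: Pk_ge0.
exact: measurable_Pk.
Qed.

(* The state of two copies driven by the same events after [(1, 0), ..., (i, 0)]. *)
Definition agree i x y := recent i x.1 y.1 /\
  forall j : 'I_n.-1, (n.-1 - i <= j)%N -> tnth x.2 j = tnth y.2 j.

Lemma agree0 x y : agree 0 x y.
Proof. by split=> [|j]; [exact: recent0|have := ltn_ord j; lia]. Qed.

Lemma agree_eq i x y : (n.-1 <= i)%N -> agree i x y -> x = y.
Proof.
case: x y => [w s] [w' s'] ni [/= rw ss]; rewrite (recent_eq n1 ni rw).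
congr (_, _); apply: eq_from_tnth => j; apply: ss; lia.
Qed.

Lemma agree_flow i r x y : agree i x y -> agree i (flow r x) (flow r y).
Proof. by move=> [rx ss]; split=> // j ij; rewrite /= !tnth_mktuple (ss j ij). Qed.

Lemma agree_jump i (u v : 'I_n) x y : val u = i.+1 -> val v = 0%N -> agree i x y ->
  agree i.+1 (jump u v x) (jump u v y).
Proof.
move=> ui v0 [rx ss]; split; first exact: recent_moran.
move=> j ij; have iu : (i < u)%N by move: ui => /= ->.
have [p1 p2] := recent_prank rx iu.
have M m (s : n.-1.-tuple R) : (m <= n.-1 - i)%N ->
    tnth (move_s s m) j = if (j.+1 < n.-1)%N then nth 0%R s j.+1 else 0%R.
  move=> mi; rewrite tnth_mktuple; have jn := ltn_ord j.
  have -> : (j.+1 < m.-1)%N = false by lia.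
  by have -> : (j.+1 == m.-1)%N = false by lia.
rewrite /= !M //; case: ifP => // jn.
have ij' : (n.-1 - i <= Ordinal jn)%N by rewrite /=; lia.
by have := ss (Ordinal jn) ij'; rewrite !(tnth_nth 0%R).
Qed.

(* A Lyapunov function for the coupling: the event [(i.+1, 0)] leads from stage
   [i] to stage [i.+1], any other one leads back to stage 0 at worst, and [cplh]
   then contracts on average by the factor [cplth]; see [cplh_step]. *)
Definition cplB : R := (N + 1)%R.
Definition cplH : R := (cplB ^+ n.-1)%R.
Definition cplh i : R := (cplH - cplB ^+ i)%R.
Definition cplth : R := (1 - cplH^-1)%R.

Lemma cplB_ge1 : (1 <= cplB)%R. Proof. by rewrite /cplB lerDr ler0n. Qed.

Lemma cplH_ge1 : (1 <= cplH)%R. Proof. exact/exprn_ege1/cplB_ge1. Qed.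

Lemma cplth_ge0 : (0 <= cplth)%R.
Proof. by rewrite subr_ge0 invf_le1 ?cplH_ge1 // (lt_le_trans _ cplH_ge1). Qed.

Lemma cplth_lt1 : (cplth < 1)%R.
Proof. by rewrite gtrBl invr_gt0 (lt_le_trans _ cplH_ge1). Qed.

Lemma cplh_ge0 i : (i <= n.-1)%N -> (0 <= cplh i)%R.
Proof. by move=> ni; rewrite subr_ge0 ler_weXn2l // cplB_ge1. Qed.

Lemma cplh_ge1 i : (i < n.-1)%N -> (1 <= cplh i)%R.
Proof.
move=> ni; have h : (cplB ^+ i.+1 <= cplH)%R by rewrite ler_weXn2l // cplB_ge1.
rewrite lerBrDr; apply: le_trans h; rewrite exprS.
have b1 : (1 <= cplB ^+ i)%R by exact/exprn_ege1/cplB_ge1.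
have N1 : (1 <= N)%R by rewrite ler1n; lia.
rewrite /cplB mulrDl mul1r lerD2r; apply: le_trans N1 _.
by rewrite ler_peMr // (le_trans _ N1).
Qed.

Lemma cpl_arith (m H b q : R) : (1 <= b)%R -> (0 <= m * q)%R ->
  ((m - 1) * (H - 1) + (H - (m + 1) * b) <= m * (H - b - 1 + q))%R.
Proof. by nra. Qed.

Lemma cplh_step i : (i < n.-1)%N ->
  ((N - 1) * cplh 0 + cplh i.+1 <= N * (cplth * cplh i))%R.
Proof.
move=> ni; rewrite /cplh /cplth expr0 exprS.
have b1 : (1 <= cplB ^+ i)%R by exact/exprn_ege1/cplB_ge1.
have H0 : (0 < cplH)%R by exact: lt_le_trans cplH_ge1.
have -> : ((1 - cplH^-1) * (cplH - cplB ^+ i) = cplH - cplB ^+ i - 1 + cplB ^+ i / cplH)%R.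
  by field; rewrite gt_eqF.
have h : (0 <= N * (cplB ^+ i / cplH))%R.
  by rewrite !mulr_ge0 ?ler0n ?invr_ge0 ?(ltW H0) // (le_trans _ b1).
exact: cpl_arith.
Qed.

Lemma Pk_couple k i t x y E : measurable E -> (i <= n.-1)%N -> (0 <= t)%R -> agree i x y ->
  Pk mu k t x E <= Pk mu k t y E + (cplh i * (cplth ^+ k * poisw k t))%:E.
Proof.
move=> mE; elim: k i t x y => [|k IH] i t x y ni t0 axy; have [ni'|ni'] := leqP n.-1 i.
- rewrite (agree_eq ni' axy) leeDl // lee_fin mulr_ge0 ?cplh_ge0 //.
  by rewrite mulr_ge0 ?poisw_ge0 // exprn_ge0 // cplth_ge0.
- apply: (@le_trans _ _ (poisw 0 t)%:E); first exact: (Pk_le 0).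
  rewrite -[leLHS]add0e leeD ?Pk_ge0 // lee_fin expr0 mul1r.
  by rewrite ler_peMl ?poisw_ge0 ?cplh_ge1.
- rewrite (agree_eq ni' axy) leeDl // lee_fin mulr_ge0 ?cplh_ge0 //.
  by rewrite mulr_ge0 ?poisw_ge0 // exprn_ge0 // cplth_ge0.
have ln : (i.+1 < n)%N by lia.
have n0 : (0 < n)%N by lia.
pose pst : 'I_n * 'I_n := (Ordinal ln, Ordinal n0).
pose hh (p : 'I_n * 'I_n) := if p == pst then cplh i.+1 else cplh 0.
have hsum : (\sum_(p <- events) hh p = (N - 1) * cplh 0 + cplh i.+1)%R.
  have pin : pst \in events by rewrite mem_filter mem_index_enum andbT.
  rewrite (big_rem _ pin) /= {1}/hh eqxx addrC; congr (_ + _)%R.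
  have u : uniq events by rewrite filter_uniq // index_enum_uniq.
  rewrite big_seq (eq_bigr (fun=> cplh 0)) -?big_seq; last first.
    by move=> p; rewrite mem_rem_uniq // inE => /andP[/negbTE pp _]; rewrite /hh pp.
  rewrite big_const_seq count_predT size_rem // size_events.
  rewrite iter_addr_0 -[LHS]mulr_natl; congr (_ * _)%R.
  by rewrite -subn1 natrB // muln_gt0; lia.
have hsum0 : (0 <= \sum_(p <- events) hh p)%R.
  rewrite hsum addr_ge0 ?cplh_ge0 // mulr_ge0 ?cplh_ge0 // subr_ge0 ler1n; lia.
pose e r := (rate r)%:E * (N * poisw k (t - r))%:E.
have me : measurable_fun setT e.
  apply: emeasurable_funM; first exact: measurable_rate.
  under eq_fun do rewrite EFinM.
  by apply: measurable_funeM; apply: measurable_poisw; exact: measurable_funB.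
have e0 r : (0 <= r <= t)%R -> 0 <= e r.
  move=> /andP[r0 rt]; rewrite mule_ge0 // lee_fin ?rate_ge0 // mulr_ge0 ?ler0n //.
  by apply: poisw_ge0; rewrite subr_ge0.
have ch0 : (0 <= cplth * cplh i * cplth ^+ k)%R.
  by rewrite !mulr_ge0 ?exprn_ge0 ?cplth_ge0 ?cplh_ge0.
rewrite !PkS.
have -> : (cplh i * (cplth ^+ k.+1 * poisw k.+1 t))%:E =
    \int[leb]_(r in `[0%R, t]) ((cplth * cplh i * cplth ^+ k)%:E * e r).
  rewrite ge0_integralZl_EFin //; last by exact: measurable_funTS.
  by rewrite int_poisw // -EFinM exprS; congr (_%:E); ring.
rewrite -ge0_integralD //; last 4 first.
- by move=> r _; exact: Pk_integrand_ge0.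
- by apply: measurable_funTS; exact: measurable_Pk_integrand.
- by move=> r rt; rewrite mule_ge0 //; exact: e0.
- by apply: measurable_funTS; exact: measurable_funeM.
apply: ge0_le_integral => //.
- by move=> r _; exact: Pk_integrand_ge0.
- by apply: measurable_funTS; exact: measurable_Pk_integrand.
- apply: measurable_funTS; apply: emeasurable_funD; first exact: measurable_Pk_integrand.
  exact: measurable_funeM.
move=> r; rewrite /= in_itv /= => /andP[r0 rt].
have tr : (0 <= t - r)%R by rewrite subr_ge0.
have pw0 := poisw_ge0 k tr.
apply: (@le_trans _ _ ((rate r)%:E *
   (\sum_(p <- events) Pk mu k (t - r)%R (jump p.1 p.2 (flow r y)) E
    + \sum_(p <- events) (hh p * (cplth ^+ k * poisw k (t - r)))%:E))).
  rewrite lee_wpmul2l ?lee_fin ?rate_ge0 // -big_split /=.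
  apply: lee_sum => p _; rewrite /hh; case: eqP => [->|_].
    by apply: IH => //; apply: agree_jump => //; exact: agree_flow.
  by apply: IH => //; exact: agree0.
rewrite ge0_muleDr; last 2 first.
- by apply: sume_ge0 => p _; exact: Pk_ge0.
- by rewrite sumEFin -mulr_suml lee_fin mulr_ge0 // mulr_ge0 // exprn_ge0 // cplth_ge0.
rewrite leeD2l // sumEFin -mulr_suml /e muleCA lee_wpmul2l ?lee_fin ?rate_ge0 //.
rewrite hsum.
have -> : (cplth * cplh i * cplth ^+ k * (N * poisw k (t - r)) =
   N * (cplth * cplh i) * (cplth ^+ k * poisw k (t - r)))%R by ring.
by rewrite ler_wpM2r ?cplh_step // mulr_ge0 // exprn_ge0 // cplth_ge0.
Qed.

Lemma Ptrans_couple t x y E : measurable E -> (0 <= t)%R ->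
  Ptrans mu t x E <= Ptrans mu t y E + (cplH * expR (- (mu * (1 - cplth) * t)))%:E.
Proof.
move=> mE t0; have c0 : (0 <= cplh 0)%R by exact: cplh_ge0.
rewrite EFinM -poisw_series ?cplth_ge0 //.
apply: (@le_trans _ _ (Ptrans mu t y E + (cplh 0)%:E * \sum_(k <oo) (cplth ^+ k * poisw k t)%:E)).
  have w0 k : 0 <= (cplth ^+ k * poisw k t)%:E.
    by rewrite lee_fin mulr_ge0 ?poisw_ge0 // exprn_ge0 // cplth_ge0.
  rewrite -nneseriesZl // /Ptrans -nneseriesD; last 2 first.
  - by move=> k _ _; exact: Pk_ge0.
  - by move=> k _ _; rewrite mule_ge0.
  apply: lee_nneseries => [k _ _|k _]; first exact: Pk_ge0.
  by rewrite -EFinM; apply: Pk_couple => //; exact: agree0.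
rewrite leeD2l // lee_wpmul2r ?lee_fin //.
  apply: nneseries_ge0 => k _ _.
  by rewrite lee_fin mulr_ge0 ?poisw_ge0 // exprn_ge0 // cplth_ge0.
by rewrite lerBlDr lerDl expr0.
Qed.

End MoranKernel.

Local Arguments iint : simpl never.

Section MeasureLemmas.
Context {R : realType} d (T : measurableType d).
Local Open Scope ereal_scope.

Lemma series_semi_sigma_additive (m : set T -> \bar R) : (forall A, 0 <= m A) ->
  (forall F : nat -> set T, (forall i, measurable (F i)) -> trivIset setT F ->
    m (\bigcup_i F i) = \sum_(i <oo) m (F i)) ->
  semi_sigma_additive m.
Proof. by move=> m0 H F mF tF _; rewrite H //; apply: is_cvg_nneseries. Qed.

Lemma indic_bigcup_series (F : nat -> set T) (x : T) : (forall i, measurable (F i)) ->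
  trivIset setT F -> (\1_(\bigcup_i F i) x)%:E = \sum_(i <oo) (\1_(F i) x : R)%:E.
Proof.
move=> mF tF; rewrite -[LHS]/(dirac x (\bigcup_i F i)) measure_bigcup //.
by apply: eq_eseriesl => i; rewrite in_setT.
Qed.

Import HBNNSimple.

Lemma ge0_functional_integral (m : {measure set T -> \bar R}) (Phi : (T -> \bar R) -> \bar R) :
  (forall A, measurable A -> Phi (fun x => (\1_A x)%:E) = m A) ->
  (forall f g, measurable_fun setT f -> measurable_fun setT g ->
    (forall x, 0 <= f x) -> (forall x, 0 <= g x) ->
    Phi (fun x => f x + g x) = Phi f + Phi g) ->
  (forall (c : R) f, (0 <= c)%R -> measurable_fun setT f -> (forall x, 0 <= f x) ->
    Phi (fun x => c%:E * f x) = c%:E * Phi f) ->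
  (forall f : (T -> \bar R)^nat, (forall i, measurable_fun setT (f i)) ->
    (forall i x, 0 <= f i x) -> (forall x, {homo f ^~ x : i j / (i <= j)%N >-> i <= j}) ->
    Phi (fun x => limn (f ^~ x)) = limn (fun i => Phi (f i))) ->
  forall f, measurable_fun setT f -> (forall x, 0 <= f x) -> \int[m]_x f x = Phi f.
Proof.
move=> Phi1 PhiD PhiZ Phim f mf f0.
pose g := nnsfun_approx measurableT mf.
have fE x : f x = limn (fun i => (g i x)%:E).
  by apply/esym/cvg_lim => //; exact: cvg_nnsfun_approx.
have mg i : measurable_fun setT (fun x => (g i x)%:E) by exact/measurable_EFinP.
have g0 i x : 0 <= (g i x)%:E by rewrite lee_fin.
have ndg x : {homo (fun i => (g i x)%:E) : i j / (i <= j)%N >-> i <= j}.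
  by move=> i j ij; rewrite lee_fin; exact/lefP/nd_nnsfun_approx.
have -> : Phi f = limn (fun i => Phi (fun x => (g i x)%:E)).
  by rewrite -Phim //; congr Phi; apply/funext => x; exact: fE.
have -> : \int[m]_x f x = limn (fun i => \int[m]_x (g i x)%:E).
  by rewrite -monotone_convergence //; apply: eq_integral => x _; exact: fE.
congr (limn _); apply/funext => i; rewrite integralT_nnsfun sintegralE.
have Phi0 : Phi (fun=> 0) = 0.
  rewrite (_ : (fun=> 0) = (fun x : T => 0%:E * cst (0 : \bar R) x)); last first.
    by apply/funext => x; rewrite mule0.
  by rewrite PhiZ //; exact: mul0e.
have gE x : (g i x)%:E = \sum_(y <- finmap.enum_fset (fset_set (range (g i)))) (y%:E * (\1_(g i @^-1` [set y]) x)%:E).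
  rewrite fimfunE fsbig_finite //= -sumEFin.
  by apply: eq_bigr => y _; rewrite EFinM.
have mpre y : measurable (g i @^-1` [set y]) by exact: measurable_sfunP.
rewrite fsbig_finite //=.
under [X in _ = Phi X]eq_fun do rewrite gE.
have : {subset finmap.enum_fset (fset_set (range (g i))) <= [pred y | (0 <= y)%R]}.
  have fin : finite_set (range (g i)) by [].
  move=> y yr; have : y \in range (g i) by rewrite -(in_fset_set fin); exact: yr.
  by rewrite inE => -[x _ <-]; rewrite inE.
elim: (finmap.enum_fset _) => [|y r IH] r0.
  by rewrite big_nil; under eq_fun do rewrite big_nil; rewrite Phi0.
have y0 : (0 <= y)%R by apply: (r0 y); rewrite inE eqxx.
have r0' : {subset r <= [pred y | (0 <= y)%R]}.
  by move=> z zr; apply: r0; rewrite inE zr orbT.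
have mi z : measurable_fun setT (fun x => (\1_(g i @^-1` [set z]) x : R)%:E).
  by apply/measurable_EFinP; exact: measurable_indic.
rewrite big_cons IH //; transitivity (Phi (fun x => y%:E * (\1_(g i @^-1` [set y]) x)%:E +
    \sum_(z <- r) (z%:E * (\1_(g i @^-1` [set z]) x)%:E))); last first.
  by congr Phi; apply/funext => x; rewrite big_cons.
rewrite PhiD; last 4 first.
- exact: measurable_funeM.
- by apply: emeasurable_sum => z; exact: measurable_funeM.
- by move=> x; rewrite mule_ge0 ?lee_fin.
- move=> x; rewrite big_seq; apply: sume_ge0 => z zr.
  by rewrite mule_ge0 ?lee_fin //; exact: (r0' z).
by rewrite PhiZ // Phi1.
Qed.

End MeasureLemmas.

Section StationaryLaw.
Context {R : realType} {k : nat}.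
Notation n := k.+2.
Notation leb := (@lebesgue_measure R).
Notation mstate := (mstate R n).
Variable mu : R.
Hypothesis mu0 : (0 < mu)%R.
Let n1 : (1 < n)%N := isT.
Local Open Scope ereal_scope.
Implicit Types (h : mstate -> \bar R) (x y : mstate) (E : set mstate) (t r b : R).

Notation C2 := ('C(n, 2)%:R : R).
Notation N := ((n * n.-1)%:R : R).

Lemma C2_gt0 : (0 < C2)%R. Proof. by rewrite ltr0n bin_gt0. Qed.

Definition al (j : nat) : R := ('C(j.+2, 2)%:R / C2 * mu)%R.
Definition Kc : R := ((mu / C2) ^+ k.+1)%R.

Lemma Kc_ge0 : (0 <= Kc)%R.
Proof. by rewrite exprn_ge0 // divr_ge0 ?ltW // C2_gt0. Qed.

Lemma al_gt0 j : (0 < al j)%R.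
Proof. by rewrite !mulr_gt0 ?invr_gt0 ?C2_gt0 // ltr0n bin_gt0. Qed.

Lemma al_incr j : (al j.+1 - al j = j.+2%:R * (mu / C2))%R.
Proof. by rewrite /al [('C(j.+3, 2))]binS bin1 natrD; ring. Qed.

Lemma al_le j : (al j <= al j.+1)%R.
Proof. by rewrite -subr_ge0 al_incr mulr_ge0 ?ler0n // divr_ge0 ?ltW // C2_gt0. Qed.

Lemma al_last : al k = mu.
Proof. by rewrite /al divff ?mul1r // gt_eqF // C2_gt0. Qed.

Lemma pi_densE (s : k.+1.-tuple R) : (pi_dens (n := n) mu s)%:E = Kc%:E * edens al s.
Proof. by rewrite /pi_dens EFinM. Qed.

Definition piF h : \bar R :=
  \sum_(w : rtree n) iint (fun s : k.+1.-tuple R => Kc%:E * (edens al s * h (w, s))).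

Lemma pi_nE E : pi_n mu E = piF (fun x => (\1_E x)%:E).
Proof.
apply: eq_bigr => w _; apply: eq_iint => s.
by rewrite pi_densE muleA.
Qed.

Lemma measurable_pair_w h (w : rtree n) : measurable_fun setT h ->
  measurable_fun setT (fun s : k.+1.-tuple R => h (w, s)).
Proof. by move=> mh; apply: (measurableT_comp mh); exact: measurable_fun_pair. Qed.

Lemma measurable_pi_integrand h (w : rtree n) : measurable_fun setT h ->
  measurable_fun setT (fun s : k.+1.-tuple R => Kc%:E * (edens al s * h (w, s))).
Proof.
by move=> mh; apply: measurable_funeM; apply: measurable_edensM; exact: measurable_pair_w.
Qed.

Lemma pi_integrand_ge0 h (w : rtree n) (s : k.+1.-tuple R) : (forall x, 0 <= h x) ->
  0 <= Kc%:E * (edens al s * h (w, s)).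
Proof. by move=> h0; rewrite !mule_ge0 ?edens_ge0 // lee_fin Kc_ge0. Qed.

Lemma piF_ge0 h : (forall x, 0 <= h x) -> 0 <= piF h.
Proof.
move=> h0; apply: sume_ge0 => w _; apply: iint_ge0 => s; exact: pi_integrand_ge0.
Qed.

Lemma eq_piF h g : h =1 g -> piF h = piF g.
Proof. by move=> /funext->. Qed.

Lemma piFD h g : measurable_fun setT h -> measurable_fun setT g ->
  (forall x, 0 <= h x) -> (forall x, 0 <= g x) ->
  piF (fun x => h x + g x) = piF h + piF g.
Proof.
move=> mh mg h0 g0.
have E w : iint (fun s : k.+1.-tuple R => Kc%:E * (edens al s * (h (w, s) + g (w, s)))) =
    iint (fun s : k.+1.-tuple R => Kc%:E * (edens al s * h (w, s))) +
    iint (fun s : k.+1.-tuple R => Kc%:E * (edens al s * g (w, s))).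
  rewrite -iintD; last 4 first.
  - exact: measurable_pi_integrand.
  - exact: measurable_pi_integrand.
  - by move=> s; exact: pi_integrand_ge0.
  - by move=> s; exact: pi_integrand_ge0.
  by apply: eq_iint => s; rewrite ge0_muleDr // ge0_muleDr ?mule_ge0 ?edens_ge0.
rewrite /piF (eq_bigr _ (fun w _ => E w)); exact: big_split.
Qed.

Lemma piFZ (c : R) h : (0 <= c)%R -> measurable_fun setT h -> (forall x, 0 <= h x) ->
  piF (fun x => c%:E * h x) = c%:E * piF h.
Proof.
move=> c0 mh h0; rewrite /piF ge0_sume_distrr; last first.
  by move=> w _; apply: iint_ge0 => s; exact: pi_integrand_ge0.
apply: eq_bigr => w _; rewrite -iintZ ?lee_fin //; last 2 first.
- exact: measurable_pi_integrand.
- by move=> s; exact: pi_integrand_ge0.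
by apply: eq_iint => s; rewrite [RHS]muleCA; congr (_ * _); rewrite muleCA.
Qed.

Lemma piF_monotone_convergence (h : (mstate -> \bar R)^nat) :
  (forall i, measurable_fun setT (h i)) -> (forall i x, 0 <= h i x) ->
  (forall x, {homo h ^~ x : i j / (i <= j)%N >-> i <= j}) ->
  piF (fun x => limn (h ^~ x)) = limn (fun i => piF (h i)).
Proof.
move=> mh h0 ndh.
pose g (w : rtree n) i (s : k.+1.-tuple R) := Kc%:E * (edens al s * h i (w, s)).
have ndg w s : {homo (g w)^~ s : i j / (i <= j)%N >-> i <= j}.
  move=> i j ij; rewrite /g lee_wpmul2l ?lee_fin ?Kc_ge0 // lee_wpmul2l ?edens_ge0 //.
  exact: ndh.
have mg w i : measurable_fun setT (g w i) by exact: measurable_pi_integrand.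
have g0 w i s : 0 <= g w i s by exact: pi_integrand_ge0.
have cg w : cvgn (fun i => iint (g w i)).
  by apply: ereal_nondecreasing_is_cvgn => i j ij; apply: le_iint => // s; exact: ndg.
rewrite /piF (lim_nnesum _ (fun=> 0)); last 2 first.
- by move=> w _; apply: nearW => i; apply: iint_ge0 => s; exact: g0.
- by move=> w _; exact: cg.
apply: eq_bigr => w _; transitivity (iint (fun s => limn ((g w) ^~ s))); last first.
  by rewrite iint_monotone_convergence.
apply: eq_iint => s; apply/esym/cvg_lim => //.
have ch : cvgn (h ^~ (w, s)) by apply: ereal_nondecreasing_is_cvgn; exact: ndh.
by apply: cvgeZl => //; apply: cvgeZl.
Qed.

(* The proof argument is a phantom on which the probability instance is keyed. *)
Definition piM of (0 < mu)%R : set mstate -> \bar R := pi_n mu.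

Let piM0 : piM mu0 set0 = 0.
Proof.
rewrite /piM pi_nE; transitivity (piF (fun x => 0%:E * cst 0 x)).
  by apply: eq_piF => x; rewrite indic0 mul0e.
by rewrite piFZ // mul0e.
Qed.

Let piM_ge0 A : 0 <= piM mu0 A.
Proof. by rewrite /piM pi_nE piF_ge0 // => x; rewrite lee_fin. Qed.

Lemma measurable_indicE E : measurable E -> measurable_fun setT (fun x => (\1_E x : R)%:E).
Proof. by move=> mE; apply/measurable_EFinP; exact: measurable_indic. Qed.

Let piM_sigma_additive : semi_sigma_additive (piM mu0).
Proof.
apply: series_semi_sigma_additive => [A|F mF tF]; first exact: piM_ge0.
have i0 i x : 0 <= (\1_(F i) x : R)%:E by rewrite lee_fin.
rewrite /piM pi_nE.
transitivity (piF (fun x => limn (fun m => \sum_(0 <= i < m) (\1_(F i) x : R)%:E))).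
  by apply: eq_piF => x; rewrite indic_bigcup_series.
rewrite piF_monotone_convergence; last 3 first.
- by move=> m; apply: emeasurable_sum => i; exact: measurable_indicE.
- by move=> m x; apply: sume_ge0.
- by move=> x i j ij; apply: lee_sum_nneg_natr => // m _ _; exact: i0.
congr (limn _); apply/funext => m; elim: m => [|m IH].
  rewrite big_geq //; transitivity (piF (fun x => 0%:E * cst 0 x)).
    by apply: eq_piF => x; rewrite big_geq // mul0e.
  by rewrite piFZ // mul0e.
rewrite big_nat_recr //= -IH pi_nE -piFD //.
- by apply: eq_piF => x; rewrite big_nat_recr.
- by apply: emeasurable_sum => i; exact: measurable_indicE.
- exact: measurable_indicE.
- by move=> x; apply: sume_ge0.
Qed.

HB.instance Definition _ := isMeasure.Build _ _ _ (piM mu0) piM0 piM_ge0 piM_sigma_additive.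

Let piM_setT : piM mu0 setT = 1.
Proof.
rewrite /piM pi_nE.
have E (w : rtree n) : iint (fun s : k.+1.-tuple R => Kc%:E * (edens al s * (\1_setT (w, s) : R)%:E)) =
    (\prod_(j < k.+1) ('C(j.+2, 2)%:R : R)^-1)%:E.
  transitivity (iint (fun s : k.+1.-tuple R => Kc%:E * edens al s)).
    by apply: eq_iint => s; rewrite indicT mule1.
  rewrite iintZ ?lee_fin ?Kc_ge0 //; last 2 first.
  - exact: measurable_edens.
  - by move=> s; exact: edens_ge0.
  rewrite iint_edens1; last exact: al_gt0.
  have -> : Kc = (\prod_(j < k.+1) (mu / C2))%R by rewrite prodr_const card_ord.
  rewrite -EFinM -big_split; congr (_%:E); apply: eq_bigr => j _.
  have c0 : C2 != 0%R by rewrite gt_eqF // C2_gt0.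
  have m0 : mu != 0%R by rewrite gt_eqF.
  have cj : 'C(j.+2, 2)%:R != 0%R :> R by rewrite pnatr_eq0 -lt0n bin_gt0.
  by rewrite /al /=; field; rewrite c0 m0 cj.
rewrite /piF (eq_bigr _ (fun w _ => E w)) sumEFin sumr_const -mulr_natl.
rewrite card_rtree // natr_prod -big_split /= big1 // => j _.
by rewrite mulfV // pnatr_eq0 -lt0n bin_gt0.
Qed.

HB.instance Definition _ := @Measure_isProbability.Build _ _ _ (piM mu0) piM_setT.

Lemma integral_pi h : measurable_fun setT h -> (forall x, 0 <= h x) ->
  \int[piM mu0]_x h x = piF h.
Proof.
apply: ge0_functional_integral => [A mA|f g|c f|f].
- by rewrite -pi_nE.
- exact: piFD.
- exact: piFZ.
- exact: piF_monotone_convergence.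
Qed.

Lemma measurable_piF d (T : measurableType d) (G : T * mstate -> \bar R) :
  measurable_fun setT G -> (forall p, 0 <= G p) ->
  measurable_fun setT (fun z => piF (fun x => G (z, x))).
Proof.
move=> mG G0; apply: emeasurable_sum => w.
apply: (measurable_iint (g := fun p : T * k.+1.-tuple R => Kc%:E * (edens al p.2 * G (p.1, (w, p.2))))).
  apply: measurable_funeM; apply: emeasurable_funM.
    by apply: measurableT_comp => //; exact: measurable_edens.
  apply: (measurableT_comp mG); apply: measurable_fun_pair => //.
  exact: measurable_fun_pair.
by move=> p; rewrite !mule_ge0 ?edens_ge0 // lee_fin Kc_ge0.
Qed.

Lemma piF_int (f : mstate * R -> \bar R) : measurable_fun setT f -> (forall p, 0 <= f p) ->
  piF (fun x => \int[leb]_r f (x, r)) = \int[leb]_r piF (fun x => f (x, r)).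
Proof.
move=> mf f0; rewrite -integral_pi; last 2 first.
- exact: measurable_lint.
- by move=> x; apply: integral_ge0.
rewrite (fubini_leb [the {sigma_finite_measure set mstate -> \bar R} of piM mu0]) //.
apply: eq_integral => r _; rewrite integral_pi //.
by apply: (measurableT_comp mf); exact: measurable_fun_pair.
Qed.

Lemma piF_int0t t (f : mstate * R -> \bar R) : measurable_fun setT f -> (forall p, 0 <= f p) ->
  piF (fun x => \int[leb]_(r in `[0%R, t]) f (x, r)) =
  \int[leb]_(r in `[0%R, t]) piF (fun x => f (x, r)).
Proof.
move=> mf f0; rewrite int_itv0t.
under eq_piF do rewrite int_itv0t.
rewrite (piF_int (f := fun p => if (0 <= p.2 <= t)%R then f p else 0)).
- apply: eq_integral => r _ /=; case: ifP => // _.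
  transitivity (piF (fun x => 0%:E * cst 0 x)).
    by apply: eq_piF => x; rewrite mul0e.
  by rewrite piFZ // mul0e.
- by apply: measurable_if0 => //; exact: measurable_itvb.
- by move=> p; exact: if0_ge0.
Qed.

Definition slice h b : \bar R := (Kc * expR (- (mu * b)))%:E *
  \sum_(w : rtree n) iint (fun s : k.-tuple R => edens al s * h (w, [tuple of rcons s b])).

Lemma slice_ge0 h b : (forall x, 0 <= h x) -> 0 <= slice h b.
Proof.
move=> h0; rewrite mule_ge0 ?lee_fin ?mulr_ge0 ?Kc_ge0 ?expR_ge0 //.
by apply: sume_ge0 => w _; exact: iint_edens_ge0.
Qed.

Lemma measurable_slice d (T : measurableType d) (G : T * mstate -> \bar R) (f : T -> R) :
  measurable_fun setT G -> measurable_fun setT f -> (forall p, 0 <= G p) ->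
  measurable_fun setT (fun z => slice (fun x => G (z, x)) (f z)).
Proof.
move=> mG mf G0; apply: emeasurable_funM.
  apply/measurable_EFinP; apply: measurable_funM => //; apply: measurableT_comp => //.
  by apply: measurableT_comp => //; exact: measurable_funM.
apply: emeasurable_sum => w.
apply: (measurable_iint (g := fun p : T * k.-tuple R =>
  edens al p.2 * G (p.1, (w, [tuple of rcons p.2 (f p.1)])))).
  apply: emeasurable_funM; first by apply: measurableT_comp => //; exact: measurable_edens.
  apply: (measurableT_comp mG); apply: measurable_fun_pair => //.
  apply: measurable_fun_pair; first exact: measurable_cst.
  by apply: measurable_fun_trcons => //; exact: measurableT_comp.
by move=> p; rewrite mule_ge0 ?edens_ge0.
Qed.

Lemma measurable_slice1 h : measurable_fun setT h -> (forall x, 0 <= h x) ->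
  measurable_fun setT (slice h).
Proof.
move=> mh h0; apply: (measurable_slice (G := fun p : R * mstate => h p.2)) => //.
exact: measurableT_comp.
Qed.

Lemma piF_slice h : measurable_fun setT h -> (forall x, 0 <= h x) ->
  piF h = \int[leb]_(b in `[0%R, +oo[) slice h b.
Proof.
move=> mh h0; rewrite /piF.
have mrc w b : measurable_fun setT (fun s : k.-tuple R => h (w, [tuple of rcons s b])).
  apply: (measurableT_comp mh); apply: measurable_fun_pair => //.
  by apply: measurable_fun_trcons.
have E w : iint (fun s : k.+1.-tuple R => Kc%:E * (edens al s * h (w, s))) =
   \int[leb]_(b in `[0%R, +oo[) ((Kc * expR (- (mu * b)))%:E *
      iint (fun s : k.-tuple R => edens al s * h (w, [tuple of rcons s b]))).
  rewrite iint_rcons //; last 2 first.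
  - exact: measurable_pi_integrand.
  - by move=> s; exact: pi_integrand_ge0.
  apply: eq_integral => b _; rewrite -iintZ //; last 3 first.
  - by rewrite lee_fin mulr_ge0 ?Kc_ge0 ?expR_ge0.
  - exact: measurable_edensM.
  - by move=> s; rewrite mule_ge0 ?edens_ge0.
  apply: eq_iint => s; rewrite edens_rcons al_last EFinM -!muleA; congr (_ * _).
  by rewrite muleCA mulNr.
rewrite (eq_bigr _ (fun w _ => E w)) -ge0_integral_sum //; last 2 first.
- move=> w; apply: measurable_funTS; apply: emeasurable_funM.
    apply/measurable_EFinP; apply: measurable_funM => //; apply: measurableT_comp => //.
    by apply: measurableT_comp => //; exact: measurable_funM.
  apply: (measurable_iint (g := fun p : R * k.-tuple R => edens al p.2 * h (w, [tuple of rcons p.2 p.1]))).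
    apply: emeasurable_funM; first by apply: measurableT_comp => //; exact: measurable_edens.
    apply: (measurableT_comp mh); apply: measurable_fun_pair => //.
    by apply: measurable_fun_trcons.
  by move=> p; rewrite mule_ge0 ?edens_ge0.
- move=> w b _; rewrite mule_ge0 ?lee_fin ?mulr_ge0 ?Kc_ge0 ?expR_ge0 //.
  exact: iint_edens_ge0.
apply: eq_integral => b _; rewrite /slice ge0_sume_distrr // => w _.
exact: iint_edens_ge0.
Qed.

Lemma tnth_trcons j (s : j.-tuple R) b (i : 'I_j.+1) :
  tnth [tuple of rcons s b] i = if (i < j)%N then nth 0%R s i else b.
Proof.
rewrite (tnth_nth 0%R) /= nth_rcons size_tuple; case: ifP => // ij.
by rewrite (_ : (i : nat) = j) ?eqxx //; have := ltn_ord i; lia.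
Qed.

Lemma flow_rcons r (w : rtree n) (s : k.-tuple R) b :
  flow r ((w, [tuple of rcons s b]) : mstate) = (w, [tuple of rcons s (b + r)%R]).
Proof.
congr (_, _); apply: eq_from_tnth => i; rewrite tnth_mktuple !tnth_trcons.
have := ltn_ord i => ik; have -> : (i.+1 == n.-1) = ~~ (i < k)%N by move: ik => /=; lia.
by case: (i < k)%N.
Qed.

Lemma slice_flow h r b : (expR (- (mu * r)))%:E * slice (fun x => h (flow r x)) b = slice h (b + r)%R.
Proof.
rewrite /slice muleA -EFinM; congr (_%:E * _).
  by rewrite mulrCA -expRD; congr (_ * expR _)%R; ring.
by apply: eq_bigr => w _; apply: eq_iint => s; rewrite flow_rcons.
Qed.

Lemma flow_jumpE b (u v : 'I_n) (w : rtree n) (s : k.+1.-tuple R) :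
  flow b (jump u v ((w, s) : mstate)) =
  (moran_tree w u v, [tuple of rcons (rho (prank w u).-1 s) b]).
Proof.
congr (_, _); apply: eq_from_tnth => i.
rewrite tnth_mktuple tnth_mktuple tnth_trcons.
have := ltn_ord i => ik; have p0 := prank_gt0 n1 w u; have pn := prank_lt w u.
have -> : (i.+1 == n.-1) = ~~ (i < k)%N by move: ik => /=; lia.
have -> : (i.+1 < n.-1)%N = (i < k)%N by [].
have A (j : nat) : (k <= j)%N -> (j.+1 < (prank w u).-1)%N = false by lia.
have B (j : nat) : (k <= j)%N -> (j.+1 == (prank w u).-1) = false by lia.
case: (ltnP i k) => ik'; first last.
  by rewrite /= A // B // add0r.
rewrite -[X in _ = X](tnth_nth 0%R (rho _ s) (Ordinal ik')) tnth_mktuple /=.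
by case: ifP => // _; case: eqP => // <-.
Qed.

Lemma slice_jump h b : measurable_fun setT h -> (forall x, 0 <= h x) ->
  (rate (n := n) mu b)%:E * \sum_(p <- events (n := n)) piF (fun x => h (flow b (jump p.1 p.2 x))) =
  slice h b.
Proof.
move=> mh h0.
pose Phi (w : rtree n) (m : nat) : \bar R := iint (fun s : k.+1.-tuple R =>
  Kc%:E * (edens al s * h (w, [tuple of rcons (rho m.-1 s) b]))).
have mrc w : measurable_fun setT (fun s : k.-tuple R => h (w, [tuple of rcons s b])).
  apply: (measurableT_comp mh); apply: measurable_fun_pair => //.
  by apply: measurable_fun_trcons.
have mrho w q : measurable_fun setT (fun s : k.+1.-tuple R => h (w, [tuple of rcons (rho q s) b])).
  by apply: (measurableT_comp (mrc w)); exact: measurable_rho.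
have -> : \sum_(p <- events (n := n)) piF (fun x => h (flow b (jump p.1 p.2 x))) =
    \sum_(w : rtree n) \sum_(u : 'I_n) \sum_(v : 'I_n | v != u) Phi (moran_tree w u v) (prank w u).
  rewrite /piF exchange_big /=; apply: eq_bigr => w _.
  rewrite events_sum; apply: eq_bigr => p _; apply: eq_iint => s.
  by rewrite flow_jumpE.
have := moran_reindex n1 Phi => /= MR.
transitivity ((rate (n := n) mu b)%:E * \sum_(w : rtree n) \sum_(m < n) (Phi w m *+ m.*2)%R).
  by congr (_ * _); exact: MR.
have Phi0 w m : 0 <= Phi w m by apply: iint_ge0 => s; rewrite !mule_ge0 ?edens_ge0 ?lee_fin ?Kc_ge0.
have E w : \sum_(m < n) (Phi w m *+ m.*2)%R =
   (N / mu * Kc)%:E * iint (fun s : k.-tuple R => edens al s * h (w, [tuple of rcons s b])).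
  rewrite big_ord_recl mulr0n add0r -(@iint_rho_sum _ al k) //; last 2 first.
  - exact: al_gt0.
  - exact: al_le.
  rewrite ge0_sume_distrr; last first.
    move=> q _; rewrite mule_ge0 //; last by apply: iint_edens_ge0.
    rewrite lee_fin; case: (q : nat) => [|j]; first by rewrite subr0 ltW // al_gt0.
    by rewrite subr_ge0 al_le.
  apply: eq_bigr => q _.
  have -> : (al q - (if (q : nat) is j.+1 then al j else 0) = q.+1%:R * (mu / C2))%R.
    case: (q : nat) => [|j]; last by rewrite al_incr.
    by rewrite subr0 /al binn; ring.
  rewrite lift0 /Phi -[q.+1.-1]/(q : nat) iintZ; last 3 first.
  - by rewrite lee_fin Kc_ge0.
  - exact: measurable_edensM.
  - by move=> s; rewrite mule_ge0 ?edens_ge0.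
  set I := iint _; rewrite muleA -EFinM.
  have I0 : 0 <= I by apply: iint_edens_ge0.
  have NC : N = (2 * C2)%R by rewrite -natrM -(mul_bin_diag n 1) bin1.
  have -> : (N / mu * Kc * (q.+1%:R * (mu / C2)) = (q.+1.*2)%:R * Kc)%R.
    by rewrite NC -muln2 natrM; field; rewrite ?(gt_eqF mu0) ?(gt_eqF C2_gt0).
  rewrite EFinM -muleA; set J := _ * I.
  have J0 : 0 <= J by rewrite mule_ge0 // lee_fin Kc_ge0.
  by rewrite -[LHS]/(J *+ q.+1.*2) -mule_natl.
rewrite (eq_bigr _ (fun w _ => E w)) /slice -ge0_sume_distrr; last first.
  by move=> w _; apply: iint_edens_ge0.
rewrite muleA -EFinM; congr (_%:E * _); rewrite /rate.
have N0 : N != 0%R by rewrite pnatr_eq0.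
have ar (a e m M : R) : m != 0%R -> M != 0%R -> (m * e / M * (M / m * a) = a * e)%R.
  by move=> m0 M0; field; rewrite m0 M0.
by apply: ar => //; rewrite gt_eqF.
Qed.


Lemma int_split0y r (f : R -> \bar R) : (0 <= r)%R -> measurable_fun setT f ->
  (forall b, 0 <= f b) -> \int[leb]_(b in `[0%R, +oo[) f b =
  \int[leb]_b (if (r <= b)%R then f b else 0) + \int[leb]_(b in `[0%R, r]) f b.
Proof.
move=> r0 mf f0; rewrite -integral_itv_bndo_bndc; last exact: measurable_funTS.
have -> : \int[leb]_(b in `[0%R, r[) f b = \int[leb]_b (if (0 <= b < r)%R then f b else 0).
  rewrite integral_mkcond; apply: eq_integral => b _; rewrite patchE.
  by rewrite mem_setE in_itv.
rewrite -ge0_integralD //.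
- rewrite int_itv0y; apply: eq_integral => b _; case: (leP r b) => rb.
    by rewrite (le_trans r0 rb) andbF adde0.
  by rewrite andbT add0e.
- by move=> b _; exact: if0_ge0.
- by apply: measurable_if0 => //; exact: measurable_fun_ler.
- by move=> b _; exact: if0_ge0.
- apply: measurable_if0 => //; apply: measurable_and; first exact: measurable_fun_ler.
  exact: measurable_fun_ltr.
Qed.

Lemma triangle_itv t r b :
  ((0 <= r <= t) && (0 <= b <= t - r))%R = ((0 <= r + b <= t) && (0 <= b <= r + b))%R.
Proof.
by apply/idP/idP => /andP[/andP[? ?] /andP[? ?]]; apply/andP; split; apply/andP; split; lra.
Qed.

Lemma int_triangle t (L : R * R -> \bar R) : measurable_fun setT L -> (forall p, 0 <= L p) ->
  \int[leb]_(r in `[0%R, t]) \int[leb]_(b in `[0%R, (t - r)%R]) L ((r + b)%R, b) =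
  \int[leb]_(r in `[0%R, t]) \int[leb]_(b in `[0%R, r]) L (r, b).
Proof.
move=> mL L0.
pose G (p : R * R) := if ((0 <= p.1 <= t) && (0 <= p.2 <= p.1))%R then L p else 0.
have G0 p : 0 <= G p by apply: if0_ge0.
have mG : measurable_fun setT G.
  by apply: measurable_if0 => //; apply: measurable_and; exact: measurable_itvb.
have mGs : measurable_fun setT (fun p : R * R => G ((p.1 + p.2)%R, p.2)).
  by apply: (measurableT_comp mG); apply: measurable_fun_pair => //; exact: measurable_funD.
transitivity (\int[leb]_r \int[leb]_b G ((r + b)%R, b)).
  rewrite int_itv0t; apply: eq_integral => r _; rewrite int_itv0t.
  case: ifP => h.
    by apply: eq_integral => b _; rewrite /G /= -triangle_itv h.
  by rewrite integral0_eq // => b _; rewrite /G /= -triangle_itv h.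
rewrite (fubini_line (f := fun p : R * R => G ((p.1 + p.2)%R, p.2))) //=.
transitivity (\int[leb]_b \int[leb]_r G (r, b)).
  apply: eq_integral => b _; apply: (lebesgue_shift b (f := fun r => G (r, b))) => //.
  by apply: (measurableT_comp mG); exact: measurable_fun_pair.
rewrite -(fubini_line mG G0) int_itv0t; apply: eq_integral => r _.
rewrite int_itv0t /G /=; case: ifP => h /=; first by [].
by rewrite integral0_eq.
Qed.

Lemma piF_flow r h : (0 <= r)%R -> measurable_fun setT h -> (forall x, 0 <= h x) ->
  (expR (- (mu * r)))%:E * piF (fun x => h (flow r x)) =
  \int[leb]_b (if (r <= b)%R then slice h b else 0).
Proof.
move=> r0 mh h0.
have mhf : measurable_fun setT (fun x => h (flow r x)).
  by apply: (measurableT_comp mh); exact: measurable_fun_flow.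
have ms := measurable_slice1 mh h0.
rewrite piF_slice // -ge0_integralZl_EFin ?expR_ge0 //; last 2 first.
- by move=> b _; exact: slice_ge0.
- by apply: measurable_funTS; exact: measurable_slice1.
under eq_integral do rewrite slice_flow.
rewrite int_itv0y -[RHS](lebesgue_shift r).
- by apply: eq_integral => b _; rewrite lerDr.
- by apply: measurable_if0 => //; exact: measurable_fun_ler.
- by move=> b; apply: if0_ge0; exact: slice_ge0.
Qed.

Lemma piF_cst (c : R) : (0 <= c)%R -> piF (fun=> c%:E) = c%:E.
Proof.
move=> c0; transitivity (piF (fun x => c%:E * (\1_setT x : R)%:E)).
  by apply: eq_piF => x; rewrite indicT mule1.
rewrite piFZ //; last exact: measurable_indicE.
by rewrite -pi_nE -/(piM mu0 setT) piM_setT mule1.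
Qed.

Lemma le_piF h g : measurable_fun setT h -> measurable_fun setT g ->
  (forall x, 0 <= h x) -> (forall x, h x <= g x) -> piF h <= piF g.
Proof.
move=> mh mg h0 hg; have g0 x : 0 <= g x by exact: le_trans (hg x).
by rewrite -!integral_pi //; exact: ge0_le_integral.
Qed.

Lemma piF_sum (I : Type) (l : seq I) (f : I -> mstate -> \bar R) :
  (forall i, measurable_fun setT (f i)) -> (forall i x, 0 <= f i x) ->
  piF (fun x => \sum_(i <- l) f i x) = \sum_(i <- l) piF (f i).
Proof.
move=> mf f0; rewrite -integral_pi; last 2 first.
- exact: emeasurable_sum.
- by move=> x; exact: sume_ge0.
rewrite ge0_integral_sum //; apply: eq_bigr => i _; exact: integral_pi.
Qed.

Section Invariance.
Variables (t : R) (E : set mstate).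
Hypotheses (t0 : (0 <= t)%R) (mE : measurable E).

Let g j r x := \sum_(p <- events (n := n)) Pk mu j (t - r)%R (jump p.1 p.2 x) E.
Let A j := piF (fun x => Pk mu j t x E).
Let c := (mu / N)%R.
Let B j := \int[leb]_(r in `[0%R, t]) (c%:E * piF (g j r)).
Let iE x := (\1_E x : R)%:E.

Let c0 : (0 <= c)%R.
Proof. by rewrite divr_ge0 ?ltW ?N_gt0. Qed.

Let g0 j r x : 0 <= g j r x.
Proof. by apply: sume_ge0 => p _; exact: Pk_ge0. Qed.

Let mg d (T : measurableType d) j (f : T -> R) (G : T -> mstate) :
  measurable_fun setT f -> measurable_fun setT G ->
  measurable_fun setT (fun z => g j (f z) (G z)).
Proof.
move=> mf mG; apply: emeasurable_sum => p; apply: measurable_Pk => //.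
  exact: measurable_funB.
exact: measurable_fun_jump.
Qed.

Let miE : measurable_fun setT iE. Proof. exact: measurable_indicE. Qed.
Let iE0 x : 0 <= iE x. Proof. by rewrite lee_fin. Qed.

Let rateE r : rate (n := n) mu r = (c * expR (- (mu * r)))%R.
Proof. by rewrite /rate /c mulrAC. Qed.

Let A_0 : A 0 = \int[leb]_b (if (t <= b)%R then slice iE b else 0).
Proof.
rewrite -piF_flow // -piFZ ?expR_ge0 //.
by apply: (measurableT_comp miE); exact: measurable_fun_flow.
Qed.

Let B_0 : B 0 = \int[leb]_(b in `[0%R, t]) slice iE b.
Proof.
have ms := measurable_slice1 miE iE0.
rewrite /B !int_itv0t -[RHS](lebesgue_reflect t); last 2 first.
- by apply: measurable_if0 => //; exact: measurable_itvb.
- by move=> b; apply: if0_ge0; exact: slice_ge0.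
apply: eq_integral => r _.
have -> : (0 <= t - r <= t)%R = (0 <= r <= t)%R.
  by rewrite subr_ge0 gerBl andbC.
case: ifP => // _; rewrite -slice_jump // piF_sum; last 2 first.
- by move=> p; apply: measurable_Pk => //; exact: measurable_jump.
- by move=> p x; exact: Pk_ge0.
rewrite rateE (EFinM c) -muleA; congr (_ * _).
rewrite ge0_sume_distrr; last by move=> p _; apply: piF_ge0 => x; exact: iE0.
apply: eq_bigr => p _; rewrite -piFZ ?expR_ge0 //.
by apply: (measurableT_comp miE); apply: measurable_fun_flow => //; exact: measurable_jump.
Qed.

Let A_S j : A j.+1 = \int[leb]_(r in `[0%R, t])
  (c%:E * \int[leb]_b (if (r <= b)%R then slice (g j r) b else 0)).
Proof.
rewrite /A; under eq_piF do rewrite PkS.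
rewrite (piF_int0t t (f := fun p : mstate * R => (rate (n := n) mu p.2)%:E * g j p.2 (flow p.2 p.1))).
- apply: eq_integral => r; rewrite inE /= in_itv /= => /andP[r0 rt].
  rewrite piFZ ?rate_ge0 //; last by apply: mg => //; exact: measurable_fun_flow.
  rewrite rateE (EFinM c) -muleA; congr (_ * _).
  by rewrite -(piF_flow (h := g j r)) //; exact: mg.
- apply: emeasurable_funM; first exact: measurable_rate.
  by apply: mg => //; exact: measurable_fun_flow.
- by move=> p; rewrite mule_ge0 ?lee_fin ?rate_ge0.
Qed.

Let mL j : measurable_fun setT (fun p : R * R => slice (g j p.1) p.2).
Proof.
apply: (measurable_slice (G := fun q : R * R * mstate => g j q.1.1 q.2)) => //.
by apply: mg => //; exact: measurableT_comp.
Qed.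

Let piF_gS j r : piF (g j.+1 r) =
  \int[leb]_(b in `[0%R, (t - r)%R]) slice (g j (r + b)%R) b.
Proof.
have Pe p x : Pk mu j.+1 (t - r)%R (jump p.1 p.2 x) E =
    \int[leb]_(b in `[0%R, (t - r)%R]) ((rate (n := n) mu b)%:E * g j (r + b)%R (flow b (jump p.1 p.2 x))).
  rewrite PkS; apply: eq_integral => b _; congr (_ * _); apply: eq_bigr => q _.
  by congr (Pk _ _ _ _ _); ring.
have mgj (p : 'I_n * 'I_n) : measurable_fun setT
    (fun q : mstate * R => g j (r + q.2)%R (flow q.2 (jump p.1 p.2 q.1))).
  apply: mg; first exact: measurable_funD.
  by apply: measurable_fun_flow => //; exact: measurable_fun_jump.
have mf (p : 'I_n * 'I_n) : measurable_fun setT (fun q : mstate * R =>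
    (rate (n := n) mu q.2)%:E * g j (r + q.2)%R (flow q.2 (jump p.1 p.2 q.1))).
  by apply: emeasurable_funM => //; exact: measurable_rate.
have f0 (p : 'I_n * 'I_n) (q : mstate * R) :
    0 <= (rate (n := n) mu q.2)%:E * g j (r + q.2)%R (flow q.2 (jump p.1 p.2 q.1)).
  by rewrite mule_ge0 ?lee_fin ?rate_ge0.
rewrite piF_sum; last 2 first.
- by move=> p; apply: measurable_Pk => //; exact: measurable_jump.
- by move=> p x; exact: Pk_ge0.
transitivity (\sum_(p <- events (n := n)) \int[leb]_(b in `[0%R, (t - r)%R])
   ((rate (n := n) mu b)%:E * piF (fun x => g j (r + b)%R (flow b (jump p.1 p.2 x))))).
  apply: eq_bigr => p _; under eq_piF do rewrite Pe.
  rewrite (piF_int0t _ (mf p) (f0 p)); apply: eq_integral => b _ /=.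
  rewrite piFZ ?rate_ge0 //; apply: mg => //.
  by apply: measurable_fun_flow => //; exact: measurable_jump.
rewrite -ge0_integral_sum //; last 2 first.
- move=> p; apply: measurable_funTS; apply: emeasurable_funM; first exact: measurable_rate.
  apply: (measurable_piF (G := fun q : R * mstate => g j (r + q.1)%R (flow q.1 (jump p.1 p.2 q.2)))) => //.
  apply: mg; first exact: measurable_funD.
  by apply: measurable_fun_flow => //; exact: measurable_fun_jump.
- by move=> p b _; rewrite mule_ge0 ?lee_fin ?rate_ge0 //; exact: piF_ge0.
apply: eq_integral => b _; rewrite -ge0_sume_distrr; last by move=> p _; exact: piF_ge0.
by rewrite slice_jump //; exact: mg.
Qed.

Let B_rec j : B j = A j.+1 + B j.+1.
Proof.
have mI1 : measurable_fun setT (fun r => \int[leb]_b (if (r <= b)%R then slice (g j r) b else 0)).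
  apply: (measurable_lint (f := fun p : R * R => if (p.1 <= p.2)%R then slice (g j p.1) p.2 else 0)).
    by apply: measurable_if0 => //; exact: measurable_fun_ler.
  by move=> p; apply: if0_ge0; exact: slice_ge0.
have mI2 : measurable_fun setT (fun r => \int[leb]_(b in `[0%R, r]) slice (g j r) b).
  apply: (measurable_int0t (f := fun p : R * R => slice (g j p.1) p.2)) => //.
  by move=> p; exact: slice_ge0.
have I10 r : 0 <= \int[leb]_b (if (r <= b)%R then slice (g j r) b else 0).
  by apply: integral_ge0 => b _; apply: if0_ge0; exact: slice_ge0.
have I20 r : 0 <= \int[leb]_(b in `[0%R, r]) slice (g j r) b.
  by apply: integral_ge0 => b _; exact: slice_ge0.
have -> : B j.+1 = \int[leb]_(r in `[0%R, t]) (c%:E * \int[leb]_(b in `[0%R, r]) slice (g j r) b).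
  rewrite /B; under eq_integral do rewrite piF_gS.
  rewrite ge0_integralZl_EFin //; last 2 first.
  - by move=> r _; apply: integral_ge0 => b _; exact: slice_ge0.
  - apply: measurable_funTS.
    apply: (measurable_int0t (f := fun p : R * R => slice (g j (p.1 + p.2)%R) p.2)).
    + apply: (measurable_slice (G := fun q : R * R * mstate => g j (q.1.1 + q.1.2)%R q.2)) => //.
      by apply: mg => //; apply: measurable_funD; exact: measurableT_comp.
    + exact: measurable_funB.
    + by move=> p; exact: slice_ge0.
  rewrite (int_triangle t (mL j)); last by move=> p; exact: slice_ge0.
  by rewrite -ge0_integralZl_EFin //; exact: measurable_funTS.
rewrite A_S -ge0_integralD //; last 4 first.
- by move=> r _; rewrite mule_ge0.
- by apply: measurable_funTS; exact: measurable_funeM.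
- by move=> r _; rewrite mule_ge0.
- by apply: measurable_funTS; exact: measurable_funeM.
apply: eq_integral => r; rewrite inE /= in_itv /= => /andP[r0 rt].
rewrite -ge0_muleDr //; congr (_ * _).
have mgr : measurable_fun setT (g j r) by exact: mg.
by rewrite piF_slice // (int_split0y r0) //; [exact: measurable_slice1|move=> b; exact: slice_ge0].
Qed.

Let A_ge0 j : 0 <= A j.
Proof. by apply: piF_ge0 => x; exact: Pk_ge0. Qed.

Let B_ge0 j : 0 <= B j.
Proof. by apply: integral_ge0 => r _; rewrite mule_ge0 //; exact: piF_ge0. Qed.

Let B_bound j : B j <= (mu * t * exp_coeff (mu * t) j)%:E.
Proof.
have e0 : (0 <= exp_coeff (mu * t) j)%R by rewrite exp_coeff_ge0 // mulr_ge0 // ltW.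
have N0 : (0 <= N)%R by exact: ler0n.
have -> : (mu * t * exp_coeff (mu * t) j)%:E = \int[leb]_(r in `[0%R, t])
     (c * (N * exp_coeff (mu * t) j))%:E.
  have cN : (c * N = mu)%R by rewrite /c divfK // pnatr_eq0.
  have lt : leb `[0%R, t]%classic = t%:E.
    rewrite lebesgue_measure_itv /= lte_fin; case: ltP => [_|t0'].
      by rewrite -EFinB subr0.
    by congr (_%:E); apply/eqP; rewrite eq_le t0 t0'.
  transitivity ((c * (N * exp_coeff (mu * t) j))%:E * t%:E).
    by rewrite -EFinM; congr (_%:E); rewrite -{1}cN; ring.
  by rewrite integral_cst //; congr (_ * _); exact/esym.
apply: ge0_le_integral => //.
- by move=> r _; rewrite mule_ge0 //; exact: piF_ge0.
- apply: measurable_funTS; apply: measurable_funeM.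
  by apply: (measurable_piF (G := fun q : R * mstate => g j q.1 q.2)) => //; exact: mg.
move=> r; rewrite /= in_itv /= => /andP[r0 rt]; rewrite (EFinM c) lee_wpmul2l ?lee_fin //.
rewrite -piF_cst; last by rewrite mulr_ge0.
apply: le_piF => //; first exact: mg.
move=> x; rewrite /g -(@sum_events_cst R n); apply: lee_sum => p _.
have tr0 : (0 <= t - r)%R by rewrite subr_ge0.
apply: (@le_trans _ _ (poisw mu j (t - r))%:E); first exact: Pk_le.
rewrite lee_fin /poisw -[leRHS]mul1r ler_pM ?expR_ge0 ?exp_coeff_ge0 //.
- by rewrite mulr_ge0 // ltW.
- by rewrite -expR0 ler_expR oppr_le0 mulr_ge0 // ltW.
have m0 : (0 <= mu)%R by exact: ltW.
rewrite /exp_coeff /= ler_wpM2r ?invr_ge0 ?ler0n // lerXn2r ?nnegrE ?mulr_ge0 //.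
by rewrite ler_pM2l // gerBl.
Qed.

Let piF_partial m : piF iE = \sum_(0 <= j < m.+1) A j + B m.
Proof.
elim: m => [|m IH]; last first.
  have -> : \sum_(0 <= j < m.+2) A j = \sum_(0 <= j < m.+1) A j + A m.+1.
    exact: big_nat_recr.
  exact: (etrans IH (etrans (congr1 (adde _) (B_rec m)) (addeA _ _ _))).
rewrite big_nat1 A_0 B_0 piF_slice // (int_split0y t0) //; first exact: measurable_slice1.
by move=> b; exact: slice_ge0.
Qed.

Lemma pi_series : \sum_(j <oo) piF (fun x => Pk mu j t x E) = pi_n mu E.
Proof.
rewrite pi_nE; apply/eqP; rewrite eq_le; apply/andP; split.
  apply: lime_le; first by apply: is_cvg_nneseries => j _ _; exact: A_ge0.
  apply: nearW => -[|m]; first by rewrite big_geq //; exact: piF_ge0.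
  by rewrite (piF_partial m) leeDl ?B_ge0.
apply/lee_addgt0Pr => e e0.
have [m hm] : exists m, (mu * t * exp_coeff (mu * t) m < e)%R.
  have : (fun m => mu * t * exp_coeff (mu * t) m)%R @ \oo --> (mu * t * 0)%R.
    by apply: cvgMr; exact: cvg_exp_coeff.
  rewrite mulr0 => /cvgr_lt /(_ e e0) [m _ h]; exists m; exact: (h m (leqnn m)).
rewrite (piF_partial m) leeD //; last first.
  by apply: le_trans (B_bound m) _; rewrite lee_fin ltW.
by apply: nneseries_lim_ge => j _ _; exact: A_ge0.
Qed.

Lemma pi_invariant : actK mu (pi_n mu) t E = pi_n mu E.
Proof.
rewrite -[LHS]/(\int[piM mu0]_x Ptrans mu t x E) -pi_series.
rewrite integral_nneseries //; last 2 first.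
- by move=> j; exact: measurable_Pk.
- by move=> j x _; exact: Pk_ge0.
apply: eq_eseriesr => j _; apply: integral_pi; first exact: measurable_Pk.
by move=> x; exact: Pk_ge0.
Qed.

End Invariance.

End StationaryLaw.

Section TotalVariation.
Context {R : realType} d (T : measurableType d).
Notation leb := (@lebesgue_measure R).
Local Open Scope ereal_scope.
Implicit Types (P : probability T R) (e : R).

Lemma integral_cst_probability P (c : \bar R) : \int[P]_x c = c.
Proof.
rewrite integral_cst // -[RHS]mule1; congr (_ * _); exact: probability_setT.
Qed.

Lemma layer_cake P (g : T -> R) : measurable_fun setT g -> (forall x, 0 <= g x)%R ->
  \int[P]_x (g x)%:E = \int[leb]_r (if (0 <= r)%R then P [set x | (r < g x)%R] else 0).
Proof.
move=> mg g0; pose G (p : T * R) : \bar R := if (0 <= p.2 < g p.1)%R then 1 else 0.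
have G0 p : 0 <= G p by rewrite /G; case: ifP.
have mg1 : measurable_fun setT (fun p : T * R => g p.1) by exact: measurableT_comp.
have mG : measurable_fun setT G.
  apply: measurable_if0 => //; apply: measurable_and; first exact: measurable_fun_ler.
  exact: measurable_fun_ltr.
transitivity (\int[P]_x \int[leb]_r G (x, r)).
  apply: eq_integral => x _; rewrite /G /=.
  transitivity (leb `[0%R, g x[%classic).
    rewrite lebesgue_measure_itv /= lte_fin; case: ltP => [_|h].
      by rewrite -EFinB subr0.
    by congr (_%:E); apply/eqP; rewrite eq_le h g0.
  rewrite -[in LHS](setIT `[0%R, g x[%classic) -integral_indic //; apply: eq_integral => r _.
  by rewrite indicE mem_setE in_itv /=; case: ifP.
rewrite (fubini_leb P mG G0); apply: eq_integral => r _; rewrite /G /=.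
case: (leP 0%R r) => r0 /=; last by rewrite integral0.
have mS : measurable [set x | (r < g x)%R].
  by rewrite -[X in measurable X]setTI; apply: measurable_fun_ltr => //; exact: measurableT.
rewrite -[in RHS](setIT [set x | (r < g x)%R]) -integral_indic //.
apply: eq_integral => x _; rewrite indicE.
by case: ifP => h; [rewrite mem_set|rewrite memNset //= h].
Qed.

Lemma le_int_of_le_measure P1 P2 e (g : T -> R) : (0 <= e)%R ->
  (forall A, measurable A -> P1 A <= P2 A + e%:E) ->
  measurable_fun setT g -> (forall x, 0 <= g x <= 2)%R ->
  \int[P1]_x (g x)%:E <= \int[P2]_x (g x)%:E + (2 * e)%:E.
Proof.
move=> e0 P12 mg g02; have g0 x : (0 <= g x)%R by case/andP: (g02 x).
have mS r : measurable [set x | (r < g x)%R].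
  by rewrite -[X in measurable X]setTI; apply: measurable_fun_ltr => //; exact: measurableT.
have mP P : measurable_fun setT (fun r : R => if (0 <= r)%R then P [set x | (r < g x)%R] else 0).
  apply: measurable_if0; first exact: measurable_fun_ler.
  rewrite (_ : (fun r => _) = fun r => \int[P]_x (if (r < g x)%R then 1 else 0)); last first.
    apply/funext => r; rewrite -[in LHS](setIT [set x | (r < g x)%R]) -integral_indic //.
    apply: eq_integral => x _; rewrite indicE.
    by case: ifP => h; [rewrite mem_set|rewrite memNset //= h].
  apply: (measurable_fun_fubini_tonelli_F (fun p : R * T => if (p.1 < g p.2)%R then 1 else 0)).
    apply: measurable_if0 => //; apply: measurable_fun_ltr => //; exact: measurableT_comp.
  by move=> p; case: ifP.
rewrite !layer_cake //.
have -> : (2 * e)%:E = \int[leb]_(r in `[0%R, 2%R]) e%:E.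
  rewrite integral_cst //; transitivity (e%:E * 2%:E); first by rewrite -EFinM mulrC.
  congr (_ * _); apply/esym; apply: etrans (lebesgue_measure_itv _) _.
  by rewrite /= lte_fin ltr0n /= -EFinB subr0.
rewrite int_itv0t -ge0_integralD //; last 4 first.
- by move=> r _; case: ifP.
- exact: mP.
- by move=> r _; case: ifP; rewrite ?lee_fin.
- by apply: measurable_if0 => //; exact: measurable_itvb.
apply: ge0_le_integral => //.
- by move=> r _; case: ifP.
- exact: mP.
- apply: emeasurable_funD; first exact: mP.
  by apply: measurable_if0 => //; exact: measurable_itvb.
move=> r _; case: (leP 0%R r) => r0 /=; last by rewrite adde0.
case: (leP r 2%R) => r2; first exact: P12.
rewrite adde0 (_ : [set x | (r < g x)%R] = set0) ?measure0 //.
apply/seteqP; split=> x //=; have /andP[_ gx] := g02 x.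
by rewrite ltNge (le_trans gx (ltW r2)).
Qed.

Lemma integral_bounded_shift P (f : T -> R) : measurable_fun setT f ->
  (forall x, `|f x| <= 1)%R ->
  \int[P]_x (f x)%:E \is a fin_num /\
  \int[P]_x (f x + 1)%:E = \int[P]_x (f x)%:E + 1.
Proof.
move=> mf f1.
have intf : P.-integrable setT (EFin \o f).
  apply: measurable_bounded_integrable => //.
    by rewrite (le_lt_trans (probability_le1 P measurableT)) // ltry.
  by exists 1%R; split=> // M M1 x _ /=; exact: le_trans (f1 x) (ltW M1).
split; first exact: integrable_fin_num.
transitivity (\int[P]_x ((f x)%:E + cst 1 x)); first by apply: eq_integral.
rewrite integralD //; last by apply: finite_measure_integrable_cst.
by rewrite integral_cst_probability.
Qed.

Lemma tv_le P1 P2 e (f : T -> R) : (0 <= e)%R ->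
  (forall A, measurable A -> P1 A <= P2 A + e%:E) ->
  (forall A, measurable A -> P2 A <= P1 A + e%:E) ->
  measurable_fun setT f -> (forall x, `|f x| <= 1)%R ->
  `| \int[P1]_x (f x)%:E - \int[P2]_x (f x)%:E | <= (2 * e)%:E.
Proof.
move=> e0 P12 P21 mf f1.
have mf1 : measurable_fun setT (fun x => f x + 1)%R by exact: measurable_funD.
have b x : (0 <= f x + 1 <= 2)%R by have := f1 x; rewrite ler_norml => /andP[? ?]; lra.
have h1 := le_int_of_le_measure e0 P12 mf1 b.
have h2 := le_int_of_le_measure e0 P21 mf1 b.
have [F1 E1] := integral_bounded_shift P1 mf f1.
have [F2 E2] := integral_bounded_shift P2 mf f1.
move: h1 h2; rewrite E1 E2 -(fineK F1) -(fineK F2).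
move: (fine _) (fine _) => a a'.
rewrite -!EFinD !lee_fin /= ler_norml => h1 h2.
by apply/andP; split; lra.
Qed.

Lemma le_integral_osc P1 P2 e (f : T -> \bar R) : (0 <= e)%R ->
  measurable_fun setT f -> (forall x, 0 <= f x) ->
  (forall x y, f x <= f y + e%:E) ->
  \int[P1]_x f x <= \int[P2]_x f x + e%:E.
Proof.
move=> e0 mf f0 osc.
have I x : f x <= \int[P2]_y f y + e%:E.
  rewrite -(integral_cst_probability P2 (f x)) -(integral_cst_probability P2 e%:E) -ge0_integralD //.
  apply: ge0_le_integral => //; exact: emeasurable_funD.
rewrite -[leRHS](integral_cst_probability P1); apply: ge0_le_integral => // x _; exact: I.
Qed.

End TotalVariation.

Section Ergodicity.
Context {R : realType} {k : nat}.
Notation n := k.+2.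
Notation mstate := (mstate R n).
Variable mu : R.
Hypothesis mu0 : (0 < mu)%R.
Let n1 : (1 < n)%N := isT.
Local Open Scope ereal_scope.

Lemma Pk_set0 j t (x : mstate) : Pk mu j t x set0 = 0.
Proof.
elim: j t x => [|j IH] t x; first by rewrite /= indic0 mule0.
rewrite PkS integral0_eq // => r _; rewrite big1 ?mule0 // => p _; exact: IH.
Qed.

Section KernelMeasure.
Variables (nu : probability mstate R) (t : R).
Hypothesis t0 : (0 <= t)%R.

Definition actM of (0 < mu)%R & (0 <= t)%R : set mstate -> \bar R := actK mu nu t.

Let actM0 : actM mu0 t0 set0 = 0.
Proof.
rewrite /actM /actK integral0_eq // => x _; rewrite /Ptrans eseries0 // => j _ _.
exact: Pk_set0.
Qed.

Let actM_ge0 A : 0 <= actM mu0 t0 A.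
Proof. by apply: integral_ge0 => x _; exact: Ptrans_ge0. Qed.

Let actM_sigma_additive : semi_sigma_additive (actM mu0 t0).
Proof.
apply: series_semi_sigma_additive => [A|F mF tF]; first exact: actM_ge0.
rewrite /actM /actK -integral_nneseries //.
- by apply: eq_integral => x _; exact: Ptrans_sigma_additive.
- by move=> i; exact: measurable_Ptrans.
- by move=> i x _; exact: Ptrans_ge0.
Qed.

HB.instance Definition _ := isMeasure.Build _ _ _ (actM mu0 t0) actM0 actM_ge0 actM_sigma_additive.

Let actM_setT : actM mu0 t0 setT = 1.
Proof.
rewrite /actM /actK (eq_integral (cst 1)); last by move=> x _; exact: Ptrans_setT.
exact: integral_cst_probability.
Qed.

HB.instance Definition _ := @Measure_isProbability.Build _ _ _ (actM mu0 t0) actM_setT.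

End KernelMeasure.

Notation H := (cplH (R := R) (n := n)).
Notation gap := (mu * (1 - cplth (R := R) (n := n)))%R.

Lemma gap_gt0 : (0 < gap)%R.
Proof. by rewrite mulr_gt0 // subr_gt0 cplth_lt1. Qed.

Lemma actK_close (nu : probability mstate R) t E : (0 <= t)%R -> measurable E ->
  actK mu nu t E <= pi_n mu E + (H * expR (- (gap * t)))%:E /\
  pi_n mu E <= actK mu nu t E + (H * expR (- (gap * t)))%:E.
Proof.
move=> t0 mE; rewrite -{1 2}(pi_invariant mu0 t0 mE).
have e0 : (0 <= H * expR (- (gap * t)))%R.
  by rewrite mulr_ge0 ?expR_ge0 // (le_trans _ (cplH_ge1 (R := R) (n := n))).
split; [apply: (le_integral_osc nu [the probability _ _ of piM mu0])
       |apply: (le_integral_osc [the probability _ _ of piM mu0] nu)] => //.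
- exact: measurable_Ptrans.
- by move=> x; exact: Ptrans_ge0.
- by move=> x y; exact: Ptrans_couple.
- exact: measurable_Ptrans.
- by move=> x; exact: Ptrans_ge0.
- by move=> x y; exact: Ptrans_couple.
Qed.

Lemma tv_actK (nu : probability mstate R) t : (0 <= t)%R ->
  tv_dist (actK mu nu t) (pi_n mu) <= (2 * (H * expR (- (gap * t))))%:E.
Proof.
move=> t0; apply: ub_ereal_sup => _ [f [mf f1] <-].
have e0 : (0 <= H * expR (- (gap * t)))%R.
  by rewrite mulr_ge0 ?expR_ge0 // (le_trans _ (cplH_ge1 (R := R) (n := n))).
apply: (tv_le (P1 := [the probability _ _ of actM nu mu0 t0])
              (P2 := [the probability _ _ of piM mu0])) => // A mA.
- exact: (actK_close nu t0 mA).1.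
- exact: (actK_close nu t0 mA).2.
Qed.

Lemma invariant_unique (nu : probability mstate R) E : measurable E ->
  (forall t, (0 <= t)%R -> actK mu nu t E = nu E) -> nu E = pi_n mu E.
Proof.
move=> mE inv; have H1 : (1 <= H)%R := cplH_ge1 (R := R) (n := n); have g0 := gap_gt0.
have small (e : R) : (0 < e)%R -> exists2 t, (0 <= t)%R & (H * expR (- (gap * t)) <= e)%R.
  move=> e0; exists (H / e / gap)%R.
    by rewrite !divr_ge0 // ?ltW // (lt_le_trans _ H1).
  rewrite mulrCA mulfV ?gt_eqF // mulr1 expRN ler_pdivrMr ?expR_gt0 //.
  rewrite mulrC -ler_pdivrMr //.
  by apply: le_trans (expR_ge1Dx _); rewrite lerDr.
apply/eqP; rewrite eq_le; apply/andP; split; apply/lee_addgt0Pr => e e0;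
  have [t t0 te] := small e e0; have [h1 h2] := actK_close nu t0 mE; rewrite inv // in h1 h2.
- by apply: le_trans h1 _; rewrite leeD2l // lee_fin.
- by apply: le_trans h2 _; rewrite leeD2l // lee_fin.
Qed.

End Ergodicity.

Theorem theorem1 (R : realType) (n : nat) (mu : R) :
  (2 <= n)%N -> 0 < mu ->
  (* pi_n is a probability measure (on X^n) ... *)
  (exists P : probability (mstate R n) R,
      forall E, measurable E -> P E = pi_n mu E)
  (* ... which is invariant for the semigroup K^t ... *)
  /\ (forall t : R, 0 <= t -> forall E : set (mstate R n), measurable E ->
        actK mu (pi_n mu) t E = pi_n mu E)
  (* ... and is the unique invariant probability measure on X^n ... *)
  /\ (forall nu : probability (mstate R n) R, nu (@Xspace R n) = 1%E ->
        (forall t : R, 0 <= t -> forall E : set (mstate R n), measurable E ->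
           actK mu nu t E = nu E) ->
        forall E : set (mstate R n), measurable E -> nu E = pi_n mu E)
  (* uniform exponential ergodicity *)
  /\ (exists D : R, exists rho : R, 0 <= rho < 1 /\
        forall nu : probability (mstate R n) R, nu (@Xspace R n) = 1%E ->
        forall t : R, 0 <= t ->
          (tv_dist (actK mu nu t) (pi_n mu) < (D * rho `^ t)%:E)%E).
Proof.
case: n => [|[|k]] // _ mu0; split; last split; last split.
- by exists [the probability _ _ of piM mu0].
- by move=> t t0 E mE; exact: pi_invariant.
- by move=> nu _ inv E mE; apply: invariant_unique => // t t0; exact: inv.
pose g := mu * (1 - cplth (R := R) (n := k.+2)).
exists (2 * cplH (R := R) (n := k.+2) + 1), (expR (- g)); split.
  rewrite expR_ge0 /= -[ltRHS]expR0 ltr_expR oppr_lt0; exact: gap_gt0.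
move=> nu _ t t0; apply: le_lt_trans (tv_actK mu0 nu t0) _.
rewrite lte_fin /powR gt_eqF ?expR_gt0 // expRK mulrN [t * g]mulrC mulrA.
by rewrite ltr_pM2r ?expR_gt0 // ltrDl.
Qed.
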